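(* Let $C$ be a proper cone with $\dim(C)\le 5$ such that the pair $(C_\square,C)$ has the Lorentz factorization property (LFP). Then $C$ is symmetric.
   Context: All vector spaces are real and finite-dimensional. A convex cone $C\subseteq V$ is proper if it is closed, pointed ($C\cap(-C)=\{0\}$) and generating (it spans $V$); $\dim(C)$ is the dimension of its linear span. The square-based cone is $C_\square=\{(x,y,z)\in\mathbb{R}^3 : |y|+|z|\le x\}$. A proper cone $C\subseteq V$ is symmetric if it is selfdual (there is an inner product on $V$ with $C=\{y\in V : \langle x,y\rangle\ge 0 \text{ for all } x\in C\}$) and its automorphism group (linear bijections of $V$ mapping $C$ onto $C$) acts transitively on the interior of $C$. For $n\ge 1$ the Lorentz cone is $L_n=\{(t,x_1,\dots,x_{n-1})\in\mathbb{R}^n : t\ge (x_1^2+\cdots+x_{n-1}^2)^{1/2}\}$; a cone is Lorentzian if it is linearly isomorphic to some $L_n$. (By Vinberg's classification, the symmetric cones of dimension $d\le 5$ are, up to isomorphism: $\mathbb{R}_+$ for $d=1$; $\mathbb{R}_+^2$ for $d=2$; $\mathbb{R}_+^3, L_3$ for $d=3$; $\mathbb{R}_+^4, L_3\oplus\mathbb{R}_+, L_4$ for $d=4$; $\mathbb{R}_+^5, L_3\oplus\mathbb{R}_+^2, L_4\oplus\mathbb{R}_+, L_5$ for $d=5$.) For proper cones $C_1\subseteq V_1$, $C_2\subseteq V_2$, $\mathrm{Pos}(C_1,C_2)$ is the set of linear maps $P:V_1\to V_2$ with $P(C_1)\subseteq C_2$, and $\mathrm{LorFact}(C_1,C_2)=\operatorname{conv}\{\beta\alpha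 : \alpha\in\mathrm{Pos}(C_1,L),\ \beta\in\mathrm{Pos}(L,C_2),\ L \text{ a Lorentzian cone}\}$. The pair $(C_1,C_2)$ has the Lorentz factorization property (LFP) if $\mathrm{LorFact}(C_1,C_2)=\mathrm{Pos}(C_1,C_2)$. *)

(* Defs.v *)
From HB Require Import structures.
From mathcomp Require Import all_boot all_order all_algebra.
From mathcomp Require Import all_classical all_reals all_analysis.

Set Implicit Arguments.
Unset Strict Implicit.
Unset Printing Implicit Defensive.

Import Order.TTheory GRing.Theory Num.Theory.
Import numFieldNormedType.Exports.

Local Open Scope classical_set_scope.
Local Open Scope ring_scope.

Section Cones.
Context {R : realType}.

Section OneSpace.
Context {V : vectType R}.
Implicit Types (C : set V) (U W : {vspace V}).

Definition least_subspace C U : Prop :=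
  C `<=` [set` U] /\ forall W, C `<=` [set` W] -> (U <= W)%VS.

(* Existence of the least subspace is [least_subspaceP]; the default value 0
   is never used. *)
Definition lspan C : {vspace V} := xget 0%VS (least_subspace C).

Lemma least_subspaceP C : least_subspace C (lspan C).
Proof.
rewrite /lspan; case: xgetP => [U _ //|noU].
have exC : exists n, `[< exists2 U : {vspace V}, C `<=` [set` U] & \dim U = n >].
  by exists (\dim {:V}); apply/asboolP; exists fullv => // x _; exact: memvf.
case: (ex_minnP exC) => n /asboolP[U CU dimU] minU.
case: (noU U); split => // W CW.
have CUW : C `<=` [set` (U :&: W)%VS].
  by move=> x Cx; rewrite /= memv_cap; apply/andP; split; [exact: CU|exact: CW].
have /eqP <- : (U :&: W)%VS == U.
  rewrite eqEdim capvSl dimU; apply: minU.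
  by apply/asboolP; exists (U :&: W)%VS.
exact: capvSr.
Qed.

Definition cone_dim C : nat := \dim (lspan C).

(* The usual topology of a finite-dimensional real vector space: the one
   transported from R^n along the coordinates in a basis (any two bases give
   the same topology). *)
Definition vtop : topologicalType :=
  initial_topology (passmx.rVof (vbasis {:V}) : V -> 'rV[R]_(\dim {:V})).

Definition convex_cone C : Prop :=
  forall (a b : R) (x y : V),
    0 <= a -> 0 <= b -> C x -> C y -> C (a *: x + b *: y).

Definition pointed_cone C : Prop := C `&` [set x | C (- x)] = [set 0].

Definition proper_cone C : Prop :=
  [/\ convex_cone C, closed (C : set vtop), pointed_cone C
    & lspan C = fullv].

(* [{dot V for idfun}]: positive definite symmetric bilinear forms on V. *)
Definition selfdual C : Prop :=
  exists ip : {dot V for (@idfun R)},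
    C = [set y | forall x, C x -> 0 <= ip x y].

Definition cone_aut C (g : 'End(V)) : Prop := bijective g /\ g @` C = C.

Definition homogeneous_cone C : Prop :=
  forall x y : V, interior (C : set vtop) x -> interior (C : set vtop) y ->
    exists2 g : 'End(V), cone_aut C g & g x = y.

Definition symmetric_cone C : Prop :=
  [/\ proper_cone C, selfdual C & homogeneous_cone C].

End OneSpace.

Definition square_cone : set 'rV[R]_3 :=
  [set v | `|v 0 1| + `|v 0 2| <= v 0 0].

(* [lorentz_cone m] is the Lorentz cone L_(m+1) in R^(m+1); the coordinate of
   index 0 is t. *)
Definition lorentz_cone (m : nat) : set 'rV[R]_m.+1 :=
  [set v | Num.sqrt (\sum_(i < m) v 0 (lift ord0 i) ^+ 2) <= v 0 0].

Definition lorentzian (W : vectType R) (L : set W) : Prop :=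
  exists (m : nat) (f : 'Hom(W, 'rV[R]_m.+1)),
    bijective f /\ f @` L = lorentz_cone (m := m).

Definition convex_hull (E : lmodType R) (A : set E) : set E :=
  smallest (@convex_set R E) A.

Definition Pos (V1 V2 : vectType R) (C1 : set V1) (C2 : set V2) :
    set 'Hom(V1, V2) :=
  [set P | P @` C1 `<=` C2].

Definition LorFact (V1 V2 : vectType R) (C1 : set V1) (C2 : set V2) :
    set 'Hom(V1, V2) :=
  convex_hull [set P : 'Hom(V1, V2) |
    exists (W : vectType R) (L : set W) (a : 'Hom(V1, W)) (b : 'Hom(W, V2)),
      [/\ lorentzian L, Pos C1 L a, Pos L C2 b & P = (b \o a)%VF]].

Definition LFP (V1 V2 : vectType R) (C1 : set V1) (C2 : set V2) : Prop :=
  LorFact C1 C2 = Pos C1 C2.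

End Cones.

(* Main.v *)
Require Import Defs.
From HB Require Import structures.
From mathcomp Require Import all_boot all_order all_algebra.
From mathcomp Require Import all_classical all_reals all_analysis.
From mathcomp Require Import ring lra.

Set Implicit Arguments.
Unset Strict Implicit.
Unset Printing Implicit Defensive.

Import Order.TTheory GRing.Theory Num.Theory.
Import numFieldNormedType.Exports.

Local Open Scope classical_set_scope.
Local Open Scope ring_scope.

(* The hypothesis is used only through the following splitting property: if [a]
   is extreme, [b] in [C] does not dominate any positive multiple of [a], and
   [0 <= c <= a + b], then [c = al a + u + w] with [0 <= u <= b] and with the
   whole hyperbola [tau al a + u / tau +- w] inside [C].  It holds for
   maps factoring through a Lorentz cone (decompose the third vector in a
   hyperbolic plane spanned by two null vectors) and is stable under convex
   combinations; it is applied to the map sending the four extreme rays of the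
   square cone to [a], [b], [c] and [a + b - c].

   Fix an order unit [e].  If [p] is extreme and [e - p] lies on the boundary,
   the splitting is a Peirce decomposition [V = R p + span (face (e - p)) + W].
   It is unique, so that [p] has a unique state (positive functional [f] with
   [f p = 1 = f e]), and the dilations [(s^2, 1, s)] are automorphisms of [C].
   The discriminants of the hyperbolas give the symmetry [f_p q = f_q p], and
   induction on faces gives a spectral theorem: every [v] is
   [\sum c_i p_i] with [\sum p_i = e].  Symmetry makes
   [<p, q> = f_p q] an inner product, for which the spectral theorem yields
   selfduality; composing the dilations by [sqrt c_i] along the [p_i] sends [e]
   to any interior [\sum c_i p_i]. *)

(** * Linear functionals *)

Lemma scalar_ext (R : realType) (V : vectType R) (x y : V) :
  (forall f : {scalar V}, f x = f y) -> x = y.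
Proof.
move=> fE; rewrite (coord_vbasis (memvf x)) (coord_vbasis (memvf y)).
by apply: eq_bigr => i _; rewrite fE.
Qed.

Section ScalarMorph.
Variables (R : realType) (V : vectType R) (f : {scalar V}).

Lemma scalar0 : f 0 = 0. Proof. exact: linear0. Qed.
Lemma scalarD x y : f (x + y) = f x + f y. Proof. exact: linearD. Qed.
Lemma scalarN x : f (- x) = - f x. Proof. exact: linearN. Qed.
Lemma scalarZ a x : f (a *: x) = a * f x. Proof. exact: linearZ. Qed.

Definition scalar_morphE := (scalar0, scalarD, scalarN, scalarZ).

End ScalarMorph.

Section HomMorph.
Variables (R : realType) (V W : vectType R) (g : 'Hom(V, W)).

Lemma hom0 : g 0 = 0. Proof. exact: linear0. Qed.
Lemma homD x y : g (x + y) = g x + g y. Proof. exact: linearD. Qed.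
Lemma homN x : g (- x) = - g x. Proof. exact: linearN. Qed.
Lemma homZ a x : g (a *: x) = a *: g x. Proof. exact: linearZ. Qed.

Definition hom_morphE := (hom0, homD, homN, homZ).

End HomMorph.

(* Linear identities hold as soon as they hold after applying any functional. *)
Ltac vring :=
  let f := fresh "f" in apply: scalar_ext => f;
  rewrite !(scalar_morphE f);
  (ring || (field; rewrite ?gt_eqF ?lt_eqF //)).

Section Scalars.
Variables (R : realType) (V : vectType R).
Implicit Types (U W : {vspace V}) (K : set V).

Lemma scalar_of_fun (f : V -> R) :
  (forall a x y, f (a *: x + y) = a * f x + f y) ->
  exists g : {scalar V}, forall x, g x = f x.
Proof.
move=> lf; pose m := GRing.isLinear.Build R V R *%R f lf.
pose g : {scalar V} := HB.pack_for {scalar V} f m.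
by exists g.
Qed.

Lemma lfun_of_fun (W : vectType R) (f : V -> W) :
  (forall a x y, f (a *: x + y) = a *: f x + f y) ->
  exists g : 'Hom(V, W), forall x, g x = f x.
Proof.
move=> lf; pose m := GRing.isLinear.Build R V W *:%R f lf.
pose g : {linear V -> W} := HB.pack_for {linear V -> W} f m.
by exists (linfun g) => x; rewrite lfunE.
Qed.

Lemma dot_of_fun (f : V -> V -> R) :
  (forall x y, f x y = f y x) ->
  (forall a x y z, f x (a *: y + z) = a * f x y + f x z) ->
  (forall x, x != 0 -> 0 < f x x) ->
  exists g : {dot V for (@idfun R)}, forall x y, g x y = f x y.
Proof.
move=> fC fl fp.
have f0 z : f z 0 = 0 by have := fl 1 z 0 0; rewrite scaler0 addr0; lra.
have fB x y z : f x (y - z) = f x y - f x z.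
  by rewrite addrC -scaleN1r fl; lra.
have fZ a x y : f x (a *: y) = a * f x y by rewrite -[a *: y]addr0 fl f0 addr0.
pose m1 := @isBilinear.Build R V V R *%R (idfun \; *%R) f
  (fun u x y => etrans (fC _ _) (etrans (fB _ _ _) (congr2 (fun a b => a - b) (fC _ _) (fC _ _)))) fB
  (fun u a x => etrans (fC _ _) (etrans (fZ _ _ _) (congr1 ( *%R a) (fC _ _))))
  (fun u a x => fZ a u x).
have fH x y : f x y = (-1) ^+ false * idfun (f y x) by rewrite expr0 mul1r fC.
pose m2 := @isHermitianSesquilinear.Build R V false idfun f fH.
pose m3 := @isDotProduct.Build R V f fp.
pose g : {dot V for (@idfun R)} := HB.pack_for {dot V for (@idfun R)} f m1 m2 m3.
by exists g.
Qed.

Lemma daddv_pi_eq0 U W w : (U :&: W = 0)%VS -> w \in W -> daddv_pi U W w = 0.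
Proof.
move=> cap wW; have capC : (W :&: U = 0)%VS by rewrite capvC.
have := @daddv_pi_add _ _ W U w capC (subvP (addvSl _ _) _ wW).
rewrite (daddv_pi_id capC wW) => /(canRL (addKr w)).
by rewrite addNr.
Qed.

Lemma separating_scalar U v : v \notin U ->
  exists g : {scalar V}, g v = 1 /\ forall u, u \in U -> g u = 0.
Proof.
move=> vU; have v0 : v != 0 by apply: contraNneq vU => ->; exact: mem0v.
have frv : free [tuple v] by rewrite seq1_free.
have cap : (<[v]> :&: U = 0)%VS.
  apply/eqP; rewrite -subv0; apply/subvP => x; rewrite memv_cap => /andP[/vlineP[k ->]].
  rewrite memv0 rpredZeq (negbTE vU) orbF => /eqP ->.
  by rewrite scale0r.
have [] := @scalar_of_fun (fun x => coord [tuple v] ord0 (daddv_pi <[v]> U x)).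
  by move=> a x y; rewrite !linearP.
move=> g gE; exists g; split=> [|u uU]; rewrite gE.
  by rewrite daddv_pi_id ?memv_line// -[X in coord _ _ X]/([tuple v]`_(@ord0 0)) coord_free.
by rewrite daddv_pi_eq0 ?linear0.
Qed.

(* M. Riesz' extension theorem. *)
Lemma positive_extension K (E : {vspace V}) (e : V) :
    K 0 -> (forall x y, K x -> K y -> K (x + y)) ->
    (forall t x, 0 <= t -> K x -> K (t *: x)) ->
    e \in E -> ~ K (- e) -> (forall v, v \in E -> exists M, K (M *: e + v)) ->
  exists f : {scalar V}, f e = 1 /\ forall c, c \in E -> K c -> 0 <= f c.
Proof.
move=> K0 KD KZ eE nKe Ke.
(* A normalised functional positive on [K] exists on the line through [e]; one on a subspace of
   largest dimension is shown to live on all of [E], since it could otherwise be extended to one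
   more vector. *)
pose good n := `[< exists U (f : {scalar V}), [/\ \dim U = n, (U <= E)%VS, e \in U,
  f e = 1 & forall c, c \in U -> K c -> 0 <= f c] >].
have ex : exists n, good n.
  have e0 : e != 0 by apply/eqP => e0; apply: nKe; rewrite e0 oppr0.
  have [|f [fe _]] := @separating_scalar 0%VS e; first by rewrite memv0.
  exists (\dim <[e]>); apply/asboolP; exists <[e]>%VS, f; split=> //.
  - exact: memv_line.
  move=> c /vlineP[k ->] Kk; rewrite linearZ/= fe mulr1 leNgt; apply/negP => k0.
  apply: nKe; have := KZ (- k^-1) _ _ Kk; rewrite scalerA mulNr mulVf ?lt_eqF// scaleN1r.
  by apply; rewrite oppr_ge0 invr_le0 ltW.
have bd n : good n -> (n <= \dim E)%N.
  by move=> /asboolP[U [f [<- UE _ _ _]]]; exact: dimvS.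
case: (ex_maxnP ex bd) => n /asboolP[U [f [dU UE eU fe fp]]] nmax.
have [UEq|/eqP UE'] := eqVneq U E.
  by exists f; split=> // c; rewrite -UEq; exact: fp.
have [v vE vU] : exists2 v, v \in E & v \notin U.
  apply: contrapT => h; apply: UE'; apply/eqP; rewrite eqEsubv UE; apply/subvP => v vE.
  by apply: contrapT => /negP vU; apply: h; exists v.
have [g [gv gU]] := separating_scalar vU.
(* Positivity asks that the value at [v] be at least each [- f u] with [K (u + v)] and at most each
   [f u] with [K (u - v)]; [sup A] meets both demands. *)
pose A := [set - f u | u in [set u | u \in U /\ K (u + v)]].
have ub u : u \in U -> K (u - v) -> ubound A (f u).
  move=> uU Ku _ [u' [u'U Ku'] <-]; rewrite -subr_ge0 opprK -linearD.
  by apply: fp; rewrite ?memvD//; have := KD _ _ Ku Ku'; rewrite addrACA addNr addr0.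
have [M KM] := Ke v vE.
have [M' KM'] : exists M, K (M *: e - v) by apply: Ke; rewrite memvN.
have supA : has_sup A.
  split; first by exists (- f (M *: e)), (M *: e) => //; split => //; exact: memvZ.
  by exists (f (M' *: e)); apply: ub => //; exact: memvZ.
pose s := sup A.
have [f' f'E] : exists f' : {scalar V}, forall x, f' x = f x + (s - f v) * g x.
  by apply: (@scalar_of_fun (fun x => _)) => a x y; rewrite !linearP/=; ring.
have f'U u t : u \in U -> f' (u + t *: v) = f u + t * s.
  by move=> uU; rewrite f'E !linearD !linearZ/= gv gU//; ring.
suff /nmax : good (\dim (U + <[v]>)%VS).
  rewrite leqNgt -dU => /negP[]; rewrite (ltn_leqif (dimv_leqif_sup (addvSl _ _))).
  by apply: contra vU => /subvP; apply; apply: (subvP (addvSr _ _)); exact: memv_line.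
apply/asboolP; exists (U + <[v]>)%VS, f'; split=> //.
- by rewrite subv_add UE -memvE vE.
- exact: (subvP (addvSl _ _)).
- by have := @f'U e 0 eU; rewrite scale0r addr0 mul0r addr0 fe.
move=> _ /memv_addP[u uU [_ /vlineP[t ->] ->]] Kc; rewrite f'U//.
have [t0|t0|t0] := ltgtP t 0.
- have : K (- t^-1 *: u - v).
    have := KZ (- t^-1) _ _ Kc; rewrite scalerDr scalerA mulNr mulVf ?lt_eqF// scaleN1r.
    by apply; rewrite oppr_ge0 invr_le0 ltW.
  move=> /ub; move=> /(_ (memvZ _ uU)) /(ge_sup supA.1).
  rewrite linearZ/= -/s mulNr => h.
  have := ler_wnM2l (ltW t0) h; rewrite mulrN mulrA mulfV ?lt_eqF// mul1r; lra.
- have : A (- f (t^-1 *: u)).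
    exists (t^-1 *: u) => //; split; first exact: memvZ.
    have := KZ (t^-1) _ _ Kc; rewrite scalerDr scalerA mulVf ?gt_eqF// scale1r.
    by apply; rewrite invr_ge0 ltW.
  move=> /(ub_le_sup supA.2); rewrite -/s linearZ/= => h.
  have := ler_wpM2l (ltW t0) h; rewrite mulrN mulrA mulfV ?gt_eqF// mul1r; lra.
- by rewrite t0 mul0r addr0; apply: fp => //; rewrite t0 scale0r addr0 in Kc.
Qed.

(** A subspace of largest dimension inside [S] absorbs each [y] of [S], as adding the line through
    [y] stays inside [S]; hence it contains the least subspace. *)
Lemma mem_lspan (S : set V) x : S 0 ->
    (forall a u v, S u -> S v -> S (a *: u + v)) ->
  x \in lspan S <-> S x.
Proof.
move=> S0 SL; have [Ssub least] := least_subspaceP S; split; last exact: Ssub.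
pose good n := `[< exists2 U : {vspace V}, [set` U] `<=` S & \dim U = n >].
have ex : exists n, good n.
  by exists 0%N; apply/asboolP; exists 0%VS; rewrite ?dimv0// => y /=; rewrite memv0 => /eqP ->.
have bd n : good n -> (n <= \dim {:V})%N.
  by move=> /asboolP[U _ <-]; exact: dimvS (subvf _).
case: (ex_maxnP ex bd) => n /asboolP[U US dU] nmax.
have /least/subvP LU : S `<=` [set` U].
  move=> y Sy /=; apply: contrapT => /negP yU.
  suff /nmax : good (\dim (U + <[y]>)%VS).
    rewrite leqNgt -dU => /negP[]; rewrite (ltn_leqif (dimv_leqif_sup (addvSl _ _))).
    by apply: contra yU => /subvP; apply; apply: (subvP (addvSr _ _)); exact: memv_line.
  apply/asboolP; exists (U + <[y]>)%VS => // _ /= /memv_addP[u uU [_ /vlineP[t ->] ->]].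
  by rewrite addrC; apply: SL => //; exact: US.
by move=> /LU; exact: US.
Qed.

End Scalars.

(** * Faces and extreme rays of a closed cone *)

Section ConeBasics.
Variables (R : realType) (V : vectType R) (C : set V).

(** Closedness is kept as a limit along rays, [cone_archimedean], so that the arguments on cones
    stay algebraic. *)
Record closed_cone : Prop := ClosedCone {
  cone0 : C 0;
  coneD : forall x y, C x -> C y -> C (x + y);
  coneZ : forall (t : R) x, 0 <= t -> C x -> C (t *: x);
  cone_pointed : forall x, C x -> C (- x) -> x = 0;
  cone_archimedean : forall x y, (forall eps : R, 0 < eps -> C (x + eps *: y)) -> C x }.

Definition extreme a : Prop :=
  [/\ C a, a <> 0 & forall x, C x -> C (a - x) -> exists t : R, x = t *: a].

(** The smallest face of [C] containing [e]. *)
Definition face e : set V := [set c | C c /\ exists M : R, C (M *: e - c)].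

Definition face_span e : {vspace V} :=
  lspan [set v | exists M : R, C (M *: e + v) /\ C (M *: e - v)].

(** For [z] in the face of [e], this puts [z] on the relative boundary of that face, to which [e] is
    interior. *)
Definition on_boundary e z : Prop := forall eps : R, 0 < eps -> ~ C (z - eps *: e).

Definition positive_on e (f : {scalar V}) : Prop := forall c, face e c -> 0 <= f c.

Hypothesis coneC : closed_cone.

Let C0 := cone0 coneC.
Let CD := coneD coneC.
Let CZ := coneZ coneC.
Let Cpt := cone_pointed coneC.
Let Carch := cone_archimedean coneC.

Lemma eq_mem_set (x y : V) : C x -> y = x -> C y.
Proof. by move=> Cx ->. Qed.

Lemma face_coef_gt0 e c : C e -> face e c -> exists2 M : R, 0 < M & C (M *: e - c).
Proof.
move=> Ce [Cc [M CM]]; exists (`|M| + 1); first by rewrite ltr_pwDr.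
have h : 0 <= `|M| + 1 - M by have := ler_norm M; lra.
by apply: (eq_mem_set (CD (CZ h Ce) CM)); vring.
Qed.

Lemma mem_face_span e v : C e ->
  v \in face_span e <-> exists M : R, C (M *: e + v) /\ C (M *: e - v).
Proof.
move=> Ce; apply: mem_lspan; first by exists 0; rewrite scale0r addr0 subr0.
move=> a u w [M [Mp Mm]] [N [Np Nm]]; exists (`|a| * M + N).
have [a0|a0] := lerP 0 a.
  rewrite (ger0_norm a0); split.
    by apply: (eq_mem_set (CD (CZ a0 Mp) Np)); vring.
  by apply: (eq_mem_set (CD (CZ a0 Mm) Nm)); vring.
rewrite (ltr0_norm a0).
have a1 : 0 <= - a by lra.
split.
  by apply: (eq_mem_set (CD (CZ a1 Mm) Np)); vring.
by apply: (eq_mem_set (CD (CZ a1 Mp) Nm)); vring.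
Qed.

Lemma face_sub_span e c : C e -> face e c -> c \in face_span e.
Proof.
move=> Ce fc; have [M M0 CM] := face_coef_gt0 Ce fc.
apply/mem_face_span => //; exists M; split => //.
by apply: CD; [apply: CZ => //; exact: ltW|exact: fc.1].
Qed.

Lemma face_self e : C e -> face e e.
Proof. by move=> Ce; split=> //; exists 1; rewrite scale1r subrr. Qed.

Lemma face0 e : C e -> face e 0.
Proof. by move=> Ce; split=> //; exists 1; rewrite scale1r subr0. Qed.

Lemma face_le e x y : C x -> C (y - x) -> face e y -> face e x.
Proof.
move=> Cx Cyx [Cy [M CM]]; split=> //; exists M.
by apply: (eq_mem_set (CD CM Cyx)); vring.
Qed.

Lemma faceD e x y : face e x -> face e y -> face e (x + y).
Proof.
move=> [Cx [M CM]] [Cy [N CN]]; split; first exact: CD.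
by exists (M + N); apply: (eq_mem_set (CD CM CN)); vring.
Qed.

Lemma faceZ e t x : 0 <= t -> face e x -> face e (t *: x).
Proof.
move=> t0 [Cx [M CM]]; split; first exact: CZ.
by exists (t * M); apply: (eq_mem_set (CZ t0 CM)); vring.
Qed.

Lemma face_trans e d x : C e -> face e d -> face d x -> face e x.
Proof.
move=> Ce fd fx; have [M M0 CM] := face_coef_gt0 fd.1 fx.
by apply: (face_le fx.1 CM); apply: faceZ => //; exact: ltW.
Qed.

Lemma face_span_sub e d : C e -> face e d -> (face_span d <= face_span e)%VS.
Proof.
move=> Ce fd; apply/subvP => v /(mem_face_span _ fd.1)[M [Mp Mm]].
have [N N0 CN] := face_coef_gt0 Ce fd.
have h : 0 <= `|M| by [].
have h' : 0 <= `|M| - M by have := ler_norm M; lra.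
have Cd := fd.1.
apply/mem_face_span => //; exists (`|M| * N); split.
  by apply: (eq_mem_set (CD (CZ h CN) (CD (CZ h' Cd) Mp))); vring.
by apply: (eq_mem_set (CD (CZ h CN) (CD (CZ h' Cd) Mm))); vring.
Qed.

Lemma face_dim_lt e d : C e -> face e d -> (forall K : R, ~ C (K *: d - e)) ->
  (\dim (face_span d) < \dim (face_span e))%N.
Proof.
move=> Ce fd nd; rewrite (ltn_leqif (dimv_leqif_sup (face_span_sub Ce fd))).
apply/negP => /subvP /(_ e (face_sub_span Ce (face_self Ce))).
by move=> /(mem_face_span _ fd.1)[M [_ /nd]].
Qed.

Lemma face_dim_ltS e d a : C e -> face e d -> face e a ->
  (forall K : R, ~ C (K *: d - a)) -> (\dim (face_span d) < \dim (face_span e))%N.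
Proof.
move=> Ce fd fa nd; apply: face_dim_lt => // K CK.
have [M M0 CM] := face_coef_gt0 Ce fa.
by apply: (nd (M * K)); apply: (eq_mem_set (CD (CZ (ltW M0) CK) CM)); vring.
Qed.

(** The admissible [t] are bounded, since otherwise [eps *: x - y] would be in [C] for all
    [eps > 0], forcing [- y] into the pointed cone; the supremum is attained by closedness. *)
Lemma max_subtraction x y t0 : C y -> y <> 0 -> C (x - t0 *: y) ->
  exists2 t : R, t0 <= t & C (x - t *: y) /\ on_boundary y (x - t *: y).
Proof.
move=> Cy y0 Ct0; pose S := [set t : R | C (x - t *: y)].
have down t s : s <= t -> S t -> S s.
  move=> st St; have h : 0 <= t - s by lra.
  by apply: (eq_mem_set (CD St (CZ h Cy))); vring.
have supS : has_sup S.
  split; first by exists t0.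
  apply: contrapT => unb; apply: y0; apply: Cpt => //.
  apply: (@Carch _ x) => eps eps0.
  have [t [St tgt]] : exists t : R, S t /\ eps^-1 < t.
    apply: contrapT => h; apply: unb; exists eps^-1 => t St.
    by rewrite leNgt; apply/negP => tgt; apply: h; exists t.
  by apply: (eq_mem_set (CZ (ltW eps0) (down _ _ (ltW tgt) St))); vring.
pose t := sup S.
have CT : C (x - t *: y).
  apply: (@Carch _ y) => eps eps0.
  have [s Ss ts] := sup_adherent eps0 supS.
  by apply: (eq_mem_set (down _ (t - eps) (ltW ts) Ss)); vring.
exists t; first exact: (ub_le_sup supS.2).
split=> // eps eps0 Ceps.
have : S (t + eps) by apply: (eq_mem_set Ceps); vring.
by move=> /(ub_le_sup supS.2); rewrite -/t; lra.
Qed.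

Lemma supporting_scalar e z : C e -> face e z -> on_boundary e z ->
  exists f : {scalar V}, [/\ f e = 1, f z = 0 & positive_on e f].
Proof.
move=> Ce fz bz.
(* Enlarging [C] by the ray of [- z] forces [f z <= 0]; that [- e] stays outside the enlarged cone
   is exactly the boundary condition on [z]. *)
pose K := [set v | exists2 s : R, 0 <= s & C (v + s *: z)].
have [|||||v vE|f [fe fp]] := @positive_extension _ _ K (face_span e) e.
- by exists 0 => //; rewrite scale0r addr0.
- move=> x y [s s0 Cs] [t t0 Ct]; exists (s + t); first exact: addr_ge0.
  by apply: (eq_mem_set (CD Cs Ct)); vring.
- move=> t x t0 [s s0 Cs]; exists (t * s); first exact: mulr_ge0.
  by apply: (eq_mem_set (CZ t0 Cs)); vring.
- exact/face_sub_span/face_self.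
- move=> [s]; rewrite le_eqVlt => /orP[/eqP <-|s0 Cs].
    rewrite scale0r addr0 => Cne; apply: (bz 1 ltr01).
    by rewrite (Cpt Ce Cne) scaler0 subr0; exact: fz.1.
  have h : 0 <= s^-1 by rewrite invr_ge0 ltW.
  apply: (bz s^-1); rewrite ?invr_gt0//; apply: (eq_mem_set (CZ h Cs)).
  by rewrite scalerDr scalerA mulVf ?gt_eqF// scale1r addrC scalerN.
- have /(mem_face_span _ Ce)[M [CM _]] := vE.
  by exists M, 0 => //; rewrite scale0r addr0.
have pf : positive_on e f.
  move=> c fc; apply: fp; first exact: face_sub_span.
  by exists 0 => //; rewrite scale0r addr0; exact: fc.1.
exists f; split=> //; apply/eqP; rewrite eq_le (pf _ fz) andbT -oppr_ge0 -linearN.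
apply: fp; first by rewrite memvN; exact: face_sub_span.
by exists 1 => //; rewrite scale1r addNr.
Qed.

(** Induction on the dimension of the face: if [z] is not extreme, some [x] below [z] is not a
    multiple of it, and subtracting from [x] as much of [z] as possible leaves a nonzero vector
    generating a smaller face. *)
Lemma exists_extreme z : C z -> z <> 0 -> exists2 a, extreme a & face z a.
Proof.
have [n] := ubnP (\dim (face_span z)); elim: n z => // n IH z dz Cz z0.
have [ez|nez] := pselect (extreme z); first by exists z => //; exact: face_self.
have [x [Cx Czx nx]] : exists x, [/\ C x, C (z - x) & forall t : R, x <> t *: z].
  apply: contrapT => h; apply: nez; split=> // x Cx Czx.
  by apply: contrapT => nt; apply: h; exists x; split=> // t xt; apply: nt; exists t.
have [|t t0 [Ct bt]] := @max_subtraction x z 0 Cz z0; first by rewrite scale0r subr0.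
have fx : face z (x - t *: z).
  have fzx : face z x by apply: face_le (face_self Cz).
  by apply: face_le fzx => //; apply: (eq_mem_set (CZ t0 Cz)); vring.
have [||a ea fa] := IH (x - t *: z) _ Ct.
- rewrite -ltnS; apply: leq_trans dz; rewrite ltnS; apply: face_dim_lt => // K CK.
  have [K0|K0] := lerP K 0.
    apply: z0; apply: Cpt => //; have h : 0 <= - K by lra.
    by apply: (eq_mem_set (CD (CZ h Ct) CK)); vring.
  have h : 0 <= K^-1 by rewrite invr_ge0 ltW.
  apply: (bt K^-1); first by rewrite invr_gt0.
  apply: (eq_mem_set (CZ h CK)).
  by rewrite (scalerBr K^-1) scalerA mulVf ?gt_eqF// scale1r.
- by move=> /eqP; rewrite subr_eq0 => /eqP; exact: nx.
by exists a => //; exact: face_trans fa.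
Qed.

End ConeBasics.

(** * Peirce decompositions and the spectral theorem *)

Lemma discriminant_le (R : realType) (X Y w : R) : 0 <= X -> 0 <= Y ->
    (forall tau, 0 < tau ->
      0 <= tau * X + tau^-1 * Y + w /\ 0 <= tau * X + tau^-1 * Y - w) ->
  w ^+ 2 <= 4 * X * Y.
Proof.
move=> X0 Y0 h.
have {}h tau : 0 < tau -> tau * `|w| <= tau ^+ 2 * X + Y.
  move=> t0; have [h1 h2] := h _ t0.
  have : `|w| <= tau * X + tau^-1 * Y by rewrite ler_norml; apply/andP; split; lra.
  move=> /(ler_wpM2l (ltW t0)) /le_trans; apply.
  by rewrite mulrDr !mulrA mulfV ?gt_eqF// mul1r -expr2.
rewrite -real_normK ?num_real//; have [->|w0] := eqVneq w 0.
  by rewrite normr0 expr0n/= !mulr_ge0.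
have {}w0 : 0 < `|w| by rewrite normr_gt0.
move: X0; rewrite le_eqVlt => /orP[/eqP X0|X0].
  (* For [X = 0] this [tau] turns the bound into [Y + 1 <= Y]. *)
  have := h ((Y + 1) / `|w|); rewrite divr_gt0 ?ltr_wpDl// => /(_ isT).
  by rewrite -X0 mulr0 add0r divfK ?gt_eqF//; lra.
(* The minimiser of the quadratic [tau ^+ 2 * X - tau * |w| + Y]. *)
have := h (`|w| / (2 * X)); rewrite divr_gt0 ?mulr_gt0// => /(_ isT) k.
have e1 : `|w| / (2 * X) * `|w| = 2 * (`|w| ^+ 2 / (4 * X)) by field; rewrite gt_eqF.
have e2 : (`|w| / (2 * X)) ^+ 2 * X = `|w| ^+ 2 / (4 * X) by field; rewrite gt_eqF.
rewrite e1 e2 in k.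
have : `|w| ^+ 2 / (4 * X) <= Y by lra.
by rewrite ler_pdivrMr ?mulr_gt0// mulrC.
Qed.

Section Peirce.
Variables (R : realType) (V : vectType R) (C : set V).

(** Multiplied by [tau], the first point is [tau ^+ 2 al p + u + tau w]: the image of [al p + u + w]
    under the dilation with eigenvalues [tau ^+ 2], [1], [tau]. *)
Definition hyperbola (p : V) (al : R) (u w : V) : Prop :=
  forall tau : R, 0 < tau ->
    C ((tau * al) *: p + tau^-1 *: u + w) /\ C ((tau * al) *: p + tau^-1 *: u - w).

Definition peirce_splitting : Prop :=
  forall a b c, extreme C a -> C b -> (forall K : R, ~ C (K *: b - a)) ->
    C c -> C (a + b - c) ->
  exists (al : R) u w, [/\ 0 <= al, C u, C (b - u), c = al *: a + u + w
    & hyperbola a al u w].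

(** The analogue of a primitive idempotent in a Jordan algebra with unit [e]: an extreme vector
    scaled so that no larger multiple of it lies below [e]. *)
Definition primitive e p : Prop :=
  [/\ extreme C p, C (e - p) & on_boundary C p (e - p)].

Definition state e p (f : {scalar V}) : Prop :=
  [/\ f p = 1, f (e - p) = 0 & positive_on C e f].

Hypothesis coneC : closed_cone C.
Hypothesis splitC : peirce_splitting.

Let C0 := cone0 coneC.
Let CD := coneD coneC.
Let CZ := coneZ coneC.
Let Cpt := cone_pointed coneC.
Let Carch := cone_archimedean coneC.

Lemma exists_primitive e a : C e -> extreme C a -> face C e a ->
  exists2 t : R, 0 < t & primitive e (t *: a).
Proof.
move=> Ce ea fa; have [Ca a0 Ea] := ea.
have [M M0 CM] := face_coef_gt0 coneC Ce fa.
have Mi : 0 < M^-1 by rewrite invr_gt0.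
have [|t tM [Ct bt]] := @max_subtraction _ _ _ coneC e a M^-1 Ca a0.
  by apply: (eq_mem_set (CZ (ltW Mi) CM)); vring.
have t0 : 0 < t by exact: lt_le_trans tM.
exists t => //; split=> //.
  split; first exact/CZ/Ca/ltW.
    by move=> /eqP; rewrite scaler_eq0 gt_eqF//= => /eqP.
  move=> x Cx Cax; have ti : 0 <= t^-1 by rewrite invr_ge0 ltW.
  have [||s xs] := Ea (t^-1 *: x).
  - exact: CZ.
  - by apply: (eq_mem_set (CZ ti Cax)); vring.
  by exists s; rewrite scalerA mulrC -scalerA -xs scalerA mulfV ?gt_eqF// scale1r.
move=> eps eps0 Ceps; apply: (bt (eps * t)); first exact: mulr_gt0.
by apply: (eq_mem_set Ceps); vring.
Qed.

(** * Peirce decomposition at one primitive vector *)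

Section Fixed.
Variables e p : V.
Hypotheses (Ce : C e) (prp : primitive e p).

Let Cp : C p. Proof. by case: prp => -[]. Qed.
Let Cb : C (e - p). Proof. by case: prp. Qed.

Lemma primitive_face : face C e p.
Proof. by apply: (face_le coneC _ _ (face_self coneC Ce)). Qed.

Lemma primitive_compl_face : face C e (e - p).
Proof.
by apply: (face_le coneC _ _ (face_self coneC Ce)) => //; apply: (eq_mem_set Cp); vring.
Qed.

Lemma primitive_notin_compl K : ~ C (K *: (e - p) - p).
Proof.
move=> CK; have [[_ p0 _] _ bp] := prp.
have [K0|K0] := lerP K 0.
  apply: p0; apply: Cpt => //; have h : 0 <= - K by lra.
  by apply: (eq_mem_set (CD (CZ h Cb) CK)); vring.
apply: (bp K^-1); first by rewrite invr_gt0.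
have h : 0 <= K^-1 by rewrite invr_ge0 ltW.
by apply: (eq_mem_set (CZ h CK)); vring.
Qed.

Lemma exists_state : exists f, state e p f.
Proof.
have [_ _ bp] := prp.
have [|f [fe fb fp]] := supporting_scalar coneC Ce primitive_compl_face.
  move=> eps eps0 Ceps; apply: (bp eps) => //.
  by apply: (eq_mem_set (CD Ceps (CZ (ltW eps0) Cb))); vring.
exists f; split=> //; move: fb; rewrite scalarD scalarN fe; lra.
Qed.

Lemma peirce_decomposition c : face C e c ->
  exists (al : R) u w, [/\ 0 <= al, face C (e - p) u, c = al *: p + u + w
    & hyperbola p al u w].
Proof.
move=> fc; have [M M0 CM] := face_coef_gt0 coneC Ce fc.
have Mi : 0 <= M^-1 by rewrite invr_ge0 ltW.
have [ep _ _] := prp.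
have [||al [u [w [al0 Cu Cbu cE hyp]]]] :=
  splitC ep Cb primitive_notin_compl (c := M^-1 *: c).
- exact/CZ/fc.1.
- by apply: (eq_mem_set (CZ Mi CM)); vring.
exists (M * al), (M *: u), (M *: w); split.
- exact/mulr_ge0/al0/ltW.
- apply: (faceZ coneC) => //; first exact: ltW.
  exact: (face_le coneC _ _ (face_self coneC Cb)).
- by rewrite -scalerA -!scalerDr -cE scalerA mulfV ?gt_eqF// scale1r.
move=> tau tau0; have [h1 h2] := hyp _ tau0; split.
  by apply: (eq_mem_set (CZ (ltW M0) h1)); vring.
by apply: (eq_mem_set (CZ (ltW M0) h2)); vring.
Qed.

Lemma hyperbola_discriminant f al u w : positive_on C e f -> 0 <= al ->
    face C e u -> hyperbola p al u w ->
  f w ^+ 2 <= 4 * (al * f p) * f u.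
Proof.
move=> pf al0 fu hyp; apply: discriminant_le.
- by rewrite mulr_ge0// pf//; exact: primitive_face.
- exact: pf.
move=> tau tau0; have [h1 h2] := hyp _ tau0.
(* The sum of the two hyperbola points; it dominates each of them, so both lie in the face where [f]
   is positive. *)
have fs : face C e (2 *: ((tau * al) *: p + tau^-1 *: u)).
  apply: (faceZ coneC) => //; apply: (faceD coneC) => //; apply: (faceZ coneC) => //.
  - by rewrite mulr_ge0// ltW.
  - exact: primitive_face.
  - by rewrite invr_ge0 ltW.
have f1 : face C e ((tau * al) *: p + tau^-1 *: u + w).
  by apply: (face_le coneC _ _ fs) => //; apply: (eq_mem_set h2); vring.
have f2 : face C e ((tau * al) *: p + tau^-1 *: u - w).
  by apply: (face_le coneC _ _ fs) => //; apply: (eq_mem_set h1); vring.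
move: (pf _ f1) (pf _ f2); rewrite !(scalar_morphE f) !mulrA.
by split.
Qed.

Lemma hyperbola_scalar0 f al u w : positive_on C e f -> 0 <= al ->
    face C e u -> hyperbola p al u w -> f p = 0 \/ f u = 0 -> f w = 0.
Proof.
move=> pf al0 fu hyp fpu; have := hyperbola_discriminant pf al0 fu hyp.
have -> : 4 * (al * f p) * f u = 0 by case: fpu => ->; rewrite !(mulr0, mul0r).
by move=> h; apply/eqP; rewrite -sqrf_eq0 eq_le h sqr_ge0.
Qed.

(** Far out on the hyperbola, [eps *: u + w] and [eps *: u - w] are in [C] for every [eps > 0], so
    [w] and [- w] are in [C]. *)
Lemma hyperbola0 u w : hyperbola p 0 u w -> w = 0.
Proof.
move=> hyp; apply: Cpt; apply: (@Carch _ u) => eps eps0.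
  have [|h _] := hyp eps^-1; first by rewrite invr_gt0.
  by apply: (eq_mem_set h); rewrite invrK; vring.
have [|_ h] := hyp eps^-1; first by rewrite invr_gt0.
by apply: (eq_mem_set h); rewrite invrK; vring.
Qed.

Lemma compl_face_sub u : face C (e - p) u -> face C e u.
Proof. exact: (face_trans coneC) primitive_compl_face. Qed.

Lemma state_compl f u : state e p f -> face C (e - p) u -> f u = 0.
Proof.
move=> [fp fb pf] fu; apply/eqP; rewrite eq_le pf ?andbT; last exact: compl_face_sub.
have [M M0 CM] := face_coef_gt0 coneC Cb fu.
have /pf : face C e (M *: (e - p) - u).
  apply: compl_face_sub; apply: (face_le coneC _ _ (faceZ coneC (ltW M0) (face_self coneC Cb))) => //.
  by apply: (eq_mem_set fu.1); vring.
by rewrite (scalarD f) (scalarN f) (scalarZ f) fb; lra.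
Qed.

Lemma state_peirce f al u w : state e p f -> 0 <= al -> face C (e - p) u ->
  hyperbola p al u w -> f (al *: p + u + w) = al.
Proof.
move=> sf al0 fu hyp; have [fp fb pf] := sf.
have fu0 := state_compl sf fu.
have fw0 := hyperbola_scalar0 pf al0 (compl_face_sub fu) hyp (or_intror fu0).
by rewrite !(scalar_morphE f) fp fu0 fw0; lra.
Qed.

(** The state reads off the coefficient [al]; when it vanishes so does [w], and only [u] remains. *)
Lemma state_eq0_face f c : state e p f -> face C e c -> f c = 0 -> face C (e - p) c.
Proof.
move=> sf fc; have [al [u [w [al0 fu cE hyp]]]] := peirce_decomposition fc.
rewrite cE (state_peirce sf al0 fu hyp) => al00.
rewrite al00 in hyp *; rewrite (hyperbola0 hyp).
by rewrite scale0r add0r addr0.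
Qed.

(* Otherwise [eps *: (e - p)] splits along [p] and [z], and moving along its
   hyperbola shows that [e - p] dominates a positive multiple of [p]. *)
Lemma boundary_sum z : face C (e - p) z -> on_boundary C (e - p) z ->
  on_boundary C e (p + z).
Proof.
move=> fz bz eps eps0 Ceps; have [ep _ _] := prp.
have [N N0 CN] := face_coef_gt0 coneC Cb fz.
have [|||al [u [w [al0 Cu Czu cE hyp]]]] :=
  splitC ep fz.1 (c := eps *: (e - p)).
- move=> K CK; apply: (@primitive_notin_compl (`|K| * N)).
  have h : 0 <= `|K| by [].
  have h' : 0 <= `|K| - K by have := ler_norm K; lra.
  by apply: (eq_mem_set (CD (CZ h CN) (CD (CZ h' fz.1) CK))); vring.
- exact/CZ/Cb/ltW.
- by apply: (eq_mem_set (CD Ceps (CZ (ltW eps0) Cp))); vring.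
move: al0; rewrite le_eqVlt => /orP[/eqP al00|al0].
  rewrite -al00 in hyp cE; have w0 := hyperbola0 hyp.
  apply: (bz eps) => //; apply: (eq_mem_set Czu).
  by rewrite cE w0 scale0r add0r addr0.
(* At [tau = 1/2] the point equals [eps *: (e - p) - (al / 2) *: p + u], and
   [u <= z <= N *: (e - p)]. *)
have [|h _] := hyp 2^-1; first by rewrite invr_gt0.
apply: (@primitive_notin_compl (2 / al * (eps + N))).
have ai : 0 <= 2 / al by rewrite divr_ge0// ltW.
apply: (eq_mem_set (CZ ai (CD h (CD Czu CN)))).
rewrite -(scalerA _ (eps + N)) scalerDl cE.
by vring.
Qed.

(** This makes the Peirce sum direct. Shift [y] by a multiple of [e - p] to a boundary point [z] of
    the face of [e - p]; a functional supporting [p + z] vanishes at [p], hence at [y], so the shift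
    is zero and [y] is in [C]. The same holds for [- y]. *)
Lemma peirce_direct y : y \in face_span C (e - p) ->
    (forall f, positive_on C e f -> f p = 0 -> f y = 0) ->
  y = 0.
Proof.
move=> ys fy.
suff Cy y' : y' \in face_span C (e - p) ->
    (forall f, positive_on C e f -> f p = 0 -> f y' = 0) -> C y'.
  apply: Cpt; first exact: Cy.
  by apply: Cy => [|f pf fp]; rewrite ?memvN// scalarN fy ?oppr0.
move=> /(mem_face_span coneC _ Cb)[M [CM CM']] {}fy.
have [b0|b0] := pselect (e - p = 0).
  by apply: (eq_mem_set CM); rewrite b0; vring.
have [|t _ [Ct bt]] := @max_subtraction _ _ _ coneC (M *: (e - p) + y') (e - p) 0 Cb b0.
  by apply: (eq_mem_set CM); vring.
set z := _ - _ in Ct bt.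
have fz : face C (e - p) z.
  by split=> //; exists (M - t + M); apply: (eq_mem_set CM'); rewrite /z; vring.
have fez : face C e (p + z).
  by apply: (faceD coneC) => //; [exact: primitive_face|exact: compl_face_sub].
have [f [fe fpz pf]] := supporting_scalar coneC Ce fez (boundary_sum fz bt).
have fp0 := pf _ primitive_face; have fz0 := pf _ (compl_face_sub fz).
have fp : f p = 0 by move: fpz; rewrite scalarD; lra.
have : f z = 0 by move: fpz; rewrite scalarD; lra.
have {}fy := fy f pf fp.
rewrite /z !(scalar_morphE f) fe fp fy => Mt.
apply: (eq_mem_set Ct); rewrite /z.
have -> : M = t by lra.
by vring.
Qed.

(** A state determines [al]. Positive functionals vanishing at [p] kill both [w] and [w'], so they
    agree on [u] and [u'], and [peirce_direct] applies. *)
Lemma peirce_unique al u w al' u' w' : 0 <= al -> 0 <= al' ->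
    face C (e - p) u -> face C (e - p) u' ->
    hyperbola p al u w -> hyperbola p al' u' w' ->
    al *: p + u + w = al' *: p + u' + w' ->
  [/\ al = al', u = u' & w = w'].
Proof.
move=> al0 al0' fu fu' hyp hyp' E.
have [f sf] := exists_state.
have alE : al = al'.
  by rewrite -(state_peirce sf al0 fu hyp) E (state_peirce sf al0' fu' hyp').
have uE : u - u' = 0.
  apply: peirce_direct => [|g pg gp].
    by apply: memvB; apply: (face_sub_span coneC).
  have gw := hyperbola_scalar0 pg al0 (compl_face_sub fu) hyp (or_introl gp).
  have gw' := hyperbola_scalar0 pg al0' (compl_face_sub fu') hyp' (or_introl gp).
  have := congr1 g E; rewrite !(scalar_morphE g) gw gw' gp; lra.
have {}uE : u = u' by apply/eqP; rewrite -subr_eq0 uE.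
by split=> //; move: E; rewrite alE uE => /addrI.
Qed.

(** The splitting of [c] has a middle term below [e - p]; by uniqueness against [c = 0 + c + 0],
    this term is [c]. *)
Lemma le_unit_le_compl c : face C (e - p) c -> C (e - c) -> C (e - p - c).
Proof.
move=> fc Cec; have [ep _ _] := prp.
have [||al [u [w [al0 Cu Cbu cE hyp]]]] :=
  splitC ep Cb primitive_notin_compl (c := c).
- exact: fc.1.
- by apply: (eq_mem_set Cec); vring.
have fu : face C (e - p) u by apply: (face_le coneC _ _ (face_self coneC Cb)).
have hyp0 : hyperbola p 0 c 0.
  move=> tau tau0; have ti : 0 <= tau^-1 by rewrite invr_ge0 ltW.
  by split; apply: (eq_mem_set (CZ ti fc.1)); vring.
have [|_ <- _] // := peirce_unique al0 (lexx 0) fu fc hyp hyp0.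
by rewrite -cE; vring.
Qed.

Lemma primitive_trans q : primitive (e - p) q -> primitive e q.
Proof.
move=> [eq Cq bq]; have Cqq : C q by case: eq.
split=> //; first by apply: (eq_mem_set (CD Cq Cp)); vring.
move=> eps eps0 Ceps; apply: (bq eps) => //.
have e1 : 0 <= 1 + eps by lra.
apply: (@eq_mem_set _ _ _ (e - p - (1 + eps) *: q)); last by vring.
apply: le_unit_le_compl.
  by apply: (faceZ coneC) => //; apply: (face_le coneC _ _ (face_self coneC Cb)).
by apply: (eq_mem_set Ceps); vring.
Qed.

(* Along the decomposition of [e - q], where [g] vanishes, the discriminant of
   [g] is an equality case; this determines [g u] and [g w] for [q], whose
   discriminant then reads [g p <= f q]. *)
Lemma state_le_sym q f g : primitive e q -> state e p f -> state e q g -> g p <= f q.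
Proof.
move=> prq sf sg; have [[Cq _ _] Ceq bq] := prq.
have [fp fb pf] := sf; have [gq gb pg] := sg.
have fq : face C e q by apply: (face_le coneC _ _ (face_self coneC Ce)).
have fd : face C e (e - q).
  by apply: (face_le coneC _ _ (face_self coneC Ce)) => //; apply: (eq_mem_set Cq); vring.
have [al [u [w [al0 fu qE hyp]]]] := peirce_decomposition fq.
have [al2 [u2 [w2 [al20 fu2 dE hyp2]]]] := peirce_decomposition fd.
(* The decompositions of [q] and [e - q] add up to that of [e], which is [p + (e - p) + 0]. *)
have [|||||||alE uE wE] := @peirce_unique (al + al2) (u + u2) (w + w2) 1 (e - p) 0.
- exact: addr_ge0.
- exact: ler01.
- exact: (faceD coneC).
- exact: (face_self coneC).
- move=> tau tau0; have [h1 h2] := hyp _ tau0; have [k1 k2] := hyp2 _ tau0.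
  by split; [apply: (eq_mem_set (CD h1 k1))|apply: (eq_mem_set (CD h2 k2))]; vring.
- move=> tau tau0; have ti : 0 <= tau^-1 by rewrite invr_ge0 ltW.
  by split; apply: (eq_mem_set (CD (CZ (ltW tau0) Cp) (CZ ti Cb))); vring.
- transitivity (q + (e - q)); last by vring.
  by rewrite {1}qE dE; vring.
have alf : f q = al by rewrite qE (state_peirce sf al0 fu hyp).
rewrite alf.
have ge : g e = 1 by move: gb; rewrite scalarD scalarN; lra.
have gp0 : 0 <= g p by apply: pg; exact: primitive_face.
have gu0 := pg _ (compl_face_sub fu).
have gu20 := pg _ (compl_face_sub fu2).
have D := hyperbola_discriminant pg al0 (compl_face_sub fu) hyp.
have D2 := hyperbola_discriminant pg al20 (compl_face_sub fu2) hyp2.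
have G1 : g u + g u2 = 1 - g p.
  by have := congr1 g uE; rewrite !(scalar_morphE g) ge.
have G2 : g w + g w2 = 0 by have := congr1 g wE; rewrite !(scalar_morphE g).
have G3 : al2 * g p + g u2 + g w2 = 0.
  by rewrite -gb dE !(scalar_morphE g).
have al2E : al2 = 1 - al by lra.
have w2E : g w2 = - (al2 * g p + g u2) by lra.
(* With [g w2 = - (al2 * g p + g u2)], the discriminant bound [D2] says that the square of
   [g u2 - al2 * g p] is at most [0]. *)
have X : g u2 = al2 * g p.
  have : (g u2 - al2 * g p) ^+ 2 <= 0.
    by rewrite w2E in D2; lra.
  by move=> h; apply/eqP; rewrite -subr_eq0 -sqrf_eq0 eq_le h sqr_ge0.
have wE' : g w = 2 * (al2 * g p) by lra.
have uE' : g u = 1 - g p - al2 * g p by lra.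
rewrite wE' uE' al2E in D.
move: gp0; rewrite le_eqVlt => /orP[/eqP <-//|gp0].
rewrite -(ler_pM2l gp0) -subr_ge0.
(* After multiplication by [g p], the claim is a quarter of the discriminant inequality [D]. *)
have -> : g p * al - g p * g p =
  (4 * (al * g p) * (1 - g p - (1 - al) * g p) - (2 * ((1 - al) * g p)) ^+ 2) / 4.
  by field.
by rewrite divr_ge0// subr_ge0.
Qed.

End Fixed.

Lemma state_sym e p q f g : C e -> primitive e p -> primitive e q ->
  state e p f -> state e q g -> g p = f q.
Proof.
by move=> Ce prp prq sf sg; apply/eqP; rewrite eq_le !(@state_le_sym e _ Ce).
Qed.

(* Induction on the face: subtract an extreme [a] below [z].  The component of [z]
   in the face of [e - a] is still on its boundary, because a functional
   supporting [z] vanishes on the other two components. *)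
Lemma boundary_in_compl_face e z : C e -> e <> 0 -> face C e z -> on_boundary C e z ->
  exists2 p, primitive e p & face C (e - p) z.
Proof.
have [n] := ubnP (\dim (face_span C e)); elim: n e z => // n IH e z de Ce e0 fz bz.
have [z0|z0] := pselect (z = 0).
  have [a ea fa] := exists_extreme coneC Ce e0.
  have [t t0 prt] := exists_primitive Ce ea fa.
  by exists (t *: a) => //; rewrite z0; apply: (face0 coneC); case: prt.
have [a' ea' fa'] := exists_extreme coneC fz.1 z0.
have [t t0 pra] := exists_primitive Ce ea' (face_trans coneC Ce fz fa').
have fza := faceZ coneC (ltW t0) fa'.
move: (t *: a') pra fza => a pra fza.
have fea := primitive_face Ce pra.
have [f [fe fz0 pf]] := supporting_scalar coneC Ce fz bz.
have fa0 : f a = 0.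
  apply/eqP; rewrite eq_le pf// andbT.
  have [M M0 CM] := face_coef_gt0 coneC fz.1 fza.
  have /pf : face C e (M *: z - a).
    apply: (face_le coneC _ _ (faceZ coneC (ltW M0) fz)) => //.
    by case: fza => Ca _; apply: (eq_mem_set Ca); vring.
  by rewrite !(scalar_morphE f) fz0; lra.
have [_ Cb _] := pra.
have [al [u [w [al0 fu zE hyp]]]] := peirce_decomposition Ce pra fz.
have feu := compl_face_sub Ce pra fu.
have fw0 := hyperbola_scalar0 Ce pra pf al0 feu hyp (or_introl fa0).
have fu0 : f u = 0.
  by move: fz0; rewrite zE !(scalar_morphE f) fa0 fw0; lra.
have fb1 : f (e - a) = 1 by rewrite !(scalar_morphE f) fe fa0; lra.
have b0 : e - a <> 0 by move=> b0; move: fb1; rewrite b0 scalar0; lra.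
have [||p prp fpu] := IH _ u _ Cb b0 fu.
- rewrite -ltnS; apply: leq_trans de; rewrite ltnS.
  apply: (face_dim_ltS coneC Ce _ fea); first exact: primitive_compl_face.
  exact: primitive_notin_compl.
- move=> eps eps0 Ceps.
  have /pf : face C e (u - eps *: (e - a)).
    by apply: (face_le coneC _ _ feu) => //; apply: (eq_mem_set (CZ (ltW eps0) Cb)); vring.
  by rewrite scalarD scalarN scalarZ fb1 fu0; lra.
have prep := primitive_trans Ce pra prp.
have [_ Cep _] := prep; have [_ Cbp _] := prp; have [[Ca _ _] _ _] := pra.
(* The state of [p] vanishes on [a] and [u], then on [w] by the discriminant, hence on [z]; this
   places [z] in the face of [e - p]. *)
exists p => //; have [g sg] := exists_state Ce prep.
have fpa : face C (e - p) a.
  by apply: (face_le coneC _ _ (face_self coneC Cep)) => //; apply: (eq_mem_set Cbp); vring.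
have fpb : face C (e - p) (e - a - p).
  by apply: (face_le coneC _ _ (face_self coneC Cep)) => //; apply: (eq_mem_set Ca); vring.
have ga := state_compl Ce prep sg fpa.
have gu := state_compl Ce prep sg (face_trans coneC Cep fpb fpu).
have [_ _ pg] := sg.
have gw := hyperbola_scalar0 Ce pra pg al0 feu hyp (or_introl ga).
apply: (state_eq0_face Ce prep sg fz).
by rewrite zE !(scalar_morphE g) ga gu gw; lra.
Qed.

(** * Frames, after Jordan frames, and spectral decompositions *)

Definition frame e (s : seq V) : Prop :=
  [/\ uniq s, forall p, p \in s -> primitive e p & \sum_(p <- s) p = e].

Lemma frame_compl e s p q : frame e s -> p \in s -> q \in s -> q != p ->
  face C (e - p) q.
Proof.
move=> [us ps se] ip iq qp.
have bE : e - p = q + \sum_(r <- [seq i <- s | i != p] | r != q) r.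
  rewrite -se (bigD1_seq p)//= -big_filter (bigD1_seq q) ?filter_uniq//=.
    by vring.
  by rewrite mem_filter qp.
have Cs : forall r, r \in s -> C r by move=> r /ps[[]].
split; first exact: Cs.
exists 1; rewrite scale1r bE addrAC subrr add0r.
rewrite big_seq_cond; elim/big_ind : _ => // r.
by rewrite mem_filter => /andP[/andP[_ /Cs]].
Qed.

Lemma frame_state e s p q f : C e -> frame e s -> p \in s -> q \in s ->
  state e p f -> f q = (q == p)%:R.
Proof.
move=> Ce frs ip iq sf; have [_ ps _] := frs; have prp := ps _ ip.
have [->|qp] := eqVneq q p; first by case: sf.
exact/(state_compl Ce prp sf)/(frame_compl frs).
Qed.

Lemma frame_coef e s p c f : C e -> frame e s -> p \in s -> state e p f ->
  f (\sum_(q <- s) c q *: q) = c p.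
Proof.
move=> Ce frs ip sf; have [us _ _] := frs.
rewrite linear_sum/= (bigD1_seq p)//= scalarZ (frame_state Ce frs ip ip sf) eqxx mulr1.
rewrite big_seq_cond big1 ?addr0// => q /andP[iq qp].
by rewrite scalarZ (frame_state Ce frs ip iq sf) (negbTE qp) mulr0.
Qed.

(** The largest [t] with [v - t *: e] in [C] is the smallest eigenvalue: the difference lies in the
    face of some [e - p], where induction diagonalises it, and [t] is then added back to every
    coefficient. *)
Theorem spectral_decomposition e v : C e -> v \in face_span C e ->
  exists s (c : V -> R), frame e s /\ v = \sum_(p <- s) c p *: p.
Proof.
have [n] := ubnP (\dim (face_span C e)); elim: n e v => // n IH e v de Ce.
move=> /(mem_face_span coneC _ Ce)[M [CM CM']].
have [e0|e0] := pselect (e = 0).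
  exists [::], (fun=> 0); rewrite !big_nil; split; first by split=> //; rewrite big_nil e0.
  by apply: Cpt; [apply: (eq_mem_set CM)|apply: (eq_mem_set CM')]; rewrite e0; vring.
have [|t _ [Ct bt]] := @max_subtraction _ _ _ coneC v e (- M) Ce e0.
  by apply: (eq_mem_set CM); vring.
have fz : face C e (v - t *: e).
  by split=> //; exists (M - t); apply: (eq_mem_set CM'); vring.
have [p prp fpz] := boundary_in_compl_face Ce e0 fz bt.
have [_ Cb bp] := prp.
have [||s [c [[us ps se] zE]]] := IH (e - p) (v - t *: e) _ Cb.
- rewrite -ltnS; apply: leq_trans de; rewrite ltnS.
  apply: (face_dim_ltS coneC Ce _ (primitive_face Ce prp)); first exact: primitive_compl_face.
  exact: primitive_notin_compl.
- exact: (face_sub_span coneC).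
have pns : p \notin s.
  apply/negP => /ps[_ Cpp _]; apply: (bp 1) => //.
  by apply: (eq_mem_set Cpp); vring.
exists (p :: s), (fun q => if q == p then t else c q + t); split.
  split; first by rewrite /= pns.
    move=> q; rewrite inE => /orP[/eqP -> //|/ps]; exact: primitive_trans.
  by rewrite big_cons se; vring.
rewrite big_cons eqxx.
rewrite (eq_big_seq (fun q => c q *: q + t *: q)); last first.
  move=> q qs; rewrite -scalerDl; case: eqVneq => // qp.
  by rewrite -qp qs in pns.
by rewrite big_split/= -zE -scaler_sumr se; vring.
Qed.

End Peirce.

(** * Selfduality and homogeneity *)

Section Symmetry.
Variables (R : realType) (V : vectType R) (C : set V).
Hypothesis coneC : closed_cone C.
Hypothesis splitC : peirce_splitting C.

Let CD := coneD coneC.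
Let CZ := coneZ coneC.

(** The algebraic form of an interior point. *)
Definition order_unit e : Prop := C e /\ face_span C e = fullv.

Lemma order_unit_face e c : order_unit e -> C c -> face C e c.
Proof.
move=> [Ce Fe] Cc; split=> //.
have /(mem_face_span coneC _ Ce)[M [_ CM]] : c \in face_span C e by rewrite Fe memvf.
by exists M.
Qed.

Lemma cone_aut_comp (g h : 'End(V)) : cone_aut C g -> cone_aut C h -> cone_aut C (g \o h)%VF.
Proof.
move=> [bg gC] [bh hC]; split.
  by apply: (eq_bij (bij_comp bg bh)) => x; rewrite /= comp_lfunE.
apply/seteqP; split=> [_ [x Cx <-]|y Cy].
  rewrite comp_lfunE -gC; exists (h x) => //.
  by rewrite -hC; exists x.
move: Cy; rewrite -{1}gC => -[z]; rewrite -{1}hC => -[x Cx <-] <-.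
by exists x => //; rewrite comp_lfunE.
Qed.

Lemma cone_aut_id : cone_aut C \1%VF.
Proof.
split; first by exists id => x; rewrite id_lfunE.
by apply/seteqP; split=> [_ [x Cx <-]|x Cx]; [rewrite id_lfunE|exists x; rewrite ?id_lfunE].
Qed.

(* In the Peirce decomposition [V = R p + span (face (e - p)) + W], multiplies
   by [s ^+ 2], [1] and [s]. *)
Lemma peirce_dilation e p (s : R) : order_unit e -> primitive C e p -> 0 < s ->
  exists2 g : 'End(V), cone_aut C g &
    g p = s ^+ 2 *: p /\ forall q, face C (e - p) q -> g q = q.
Proof.
move=> ue prp s0; have [Ce Fe] := ue; have [[Cp _ _] Cb _] := prp.
have [f sf] := exists_state coneC Ce prp.
have [fp fb pf] := sf.
pose U := face_span C (e - p).
(* [S] contains [p] and the [w] of every decomposition, so [Q] below extracts the component [u],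
   while the state [f] extracts [al]. *)
pose S := [set v | forall f : {scalar V}, positive_on C e f -> f p = 0 -> f v = 0].
pose T := lspan S.
have memT v : v \in T <-> S v.
  apply: mem_lspan => [h _ _|a x y Sx Sy h ph hp]; first exact: scalar0.
  by rewrite !(scalar_morphE h) (Sx h)// (Sy h)//; lra.
have cap : (U :&: T = 0)%VS.
  apply/eqP; rewrite -subv0; apply/subvP => x.
  rewrite memv_cap memv0 => /andP[xU /memT Sx].
  exact/eqP/(peirce_direct coneC splitC Ce prp xU).
pose Q := daddv_pi U T.
have QU u : u \in U -> Q u = u by exact: daddv_pi_id.
have QT w : S w -> Q w = 0 by move=> /memT; exact: daddv_pi_eq0.
have Qp : Q p = 0 by apply: QT => h _.
have fU u : u \in U -> f u = 0.
  move=> /(mem_face_span coneC _ Cb)[M [CM CM']].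
  have f2 : face C (e - p) (2 * M *: (e - p)).
    split; first by apply: (eq_mem_set (CD CM CM')); vring.
    by exists (2 * M); rewrite subrr; exact: cone0 coneC.
  have h1 : face C (e - p) (M *: (e - p) + u).
    by apply: (face_le coneC CM _ f2); apply: (eq_mem_set CM'); vring.
  have := state_compl coneC Ce prp sf h1.
  by rewrite !(scalar_morphE f) fp; move: fb; rewrite scalarD scalarN fp => ->; lra.
have fQ v : f (Q v) = 0 by apply: fU; exact: memv_pi.
have QQ v : Q (Q v) = Q v by apply: QU; exact: memv_pi.
pose G t v := t ^+ 2 * f v *: p + Q v + t *: (v - f v *: p - Q v).
have lG t : exists g : 'End(V), forall v, g v = G t v.
  apply: (@lfun_of_fun _ _ _ (G t)) => a x y.
  by rewrite /G (homD Q) (homZ Q) !(scalar_morphE f); vring.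
have GG t r v : G t (G r v) = G (t * r) v.
  have Qv : Q (G r v) = Q v.
    by rewrite /G !(hom_morphE Q) Qp QQ; vring.
  have fv : f (G r v) = r ^+ 2 * f v.
    by rewrite /G !(scalar_morphE f) fp fQ; ring.
  by rewrite {1}/G Qv fv /G; vring.
have G1 v : G 1 v = v by rewrite /G; vring.
have GC t c : 0 < t -> C c -> C (G t c).
  move=> t0 Cc; have fc := order_unit_face ue Cc.
  have [al [u [w [al0 fu cE hyp]]]] := peirce_decomposition coneC splitC Ce prp fc.
  have fal : f c = al by rewrite cE (state_peirce coneC Ce prp sf al0 fu hyp).
  have uU : u \in U by apply: face_sub_span.
  have Sw : S w.
    move=> h ph hp.
    exact: (hyperbola_scalar0 coneC Ce prp ph al0 (compl_face_sub coneC Ce prp fu) hyp (or_introl hp)).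
  have Qc : Q c = u.
    by rewrite cE !(hom_morphE Q) Qp (QU _ uU) (QT _ Sw); vring.
  (* [G t c] is [t] times the point of parameter [t] on the hyperbola of [c]. *)
  have [h _] := hyp _ t0.
  apply: (eq_mem_set (CZ (ltW t0) h)); rewrite /G fal Qc cE.
  by vring.
have [g gE] := lG s; exists g; last split.
- split.
    have [h hE] := lG s^-1; exists h => v.
      by rewrite hE gE GG mulVf ?gt_eqF.
    by rewrite hE gE GG mulfV ?gt_eqF.
  apply/seteqP; split=> [_ [x Cx <-]|y Cy]; first by rewrite gE; exact: GC.
  exists (G s^-1 y); first by apply: GC; rewrite ?invr_gt0.
  by rewrite gE GG mulfV ?gt_eqF.
- by rewrite gE /G fp Qp; vring.
- move=> q fq; have qU : q \in U by apply: face_sub_span.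
  by rewrite gE /G (QU _ qU) (fU _ qU); vring.
Qed.

Lemma order_unit_transitive x y : order_unit x -> order_unit y ->
  exists2 g : 'End(V), cone_aut C g & g x = y.
Proof.
move=> ux uy; have [Cx Fx] := ux; have [Cy Fy] := uy.
have [|s [c [frs yE]]] := spectral_decomposition coneC splitC Cx (v := y).
  by rewrite Fx memvf.
have [us ps sx] := frs.
(* The state of [p] takes the value [c p] at [y], and [M *: y - x] in [C] gives [M * c p >= 1]. *)
have c0 p : p \in s -> 0 < c p.
  move=> ip; have prp := ps _ ip.
  have [f sf] := exists_state coneC Cx prp.
  have [M M0 CM] := face_coef_gt0 coneC Cy (order_unit_face uy Cx).
  have [fp fb pf] := sf.
  have := pf _ (order_unit_face ux CM).
  rewrite !(scalar_morphE f) yE (frame_coef coneC c Cx frs ip sf).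
  have -> : f x = 1 by move: fb; rewrite scalarD scalarN; lra.
  by rewrite -(pmulr_rgt0 _ M0); lra.
(* One dilation per frame vector: the one at [q] scales [q] by [c q] and fixes the other vectors,
   which lie in the face of [x - q]. *)
have step t : uniq t -> {subset t <= s} -> exists2 g : 'End(V), cone_aut C g &
    forall p, p \in s -> g p = (if p \in t then c p else 1) *: p.
  elim: t => [|q t IH] /=.
    by exists \1%VF; [exact: cone_aut_id|move=> p _; rewrite id_lfunE scale1r].
  move=> /andP[qt ut] sub; have iq : q \in s by apply: sub; rewrite mem_head.
  have sub' : {subset t <= s} by move=> p pt; apply: sub; rewrite inE pt orbT.
  have [g gC gE] := IH ut sub'.
  have [|h hC [hq hE]] := peirce_dilation ux (ps _ iq) (s := Num.sqrt (c q)).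
    by rewrite sqrtr_gt0 c0.
  exists (h \o g)%VF; first exact: cone_aut_comp.
  move=> p ip; rewrite comp_lfunE gE// linearZ/= inE.
  have [->|pq] := eqVneq p q.
    by rewrite (negbTE qt) hq sqr_sqrtr ?(ltW (c0 _ _))// scale1r.
  by rewrite hE//; exact: frame_compl frs iq ip pq.
have [g gC gE] := step s us (fun _ => id); exists g => //.
rewrite -sx linear_sum yE; apply: eq_big_seq => p ip /=.
by rewrite gE// ip.
Qed.

Lemma order_unit_selfdual e : order_unit e -> selfdual C.
Proof.
move=> ue; have [Ce Fe] := ue.
have [al alP] : {al : V -> {scalar V} & forall p, primitive C e p -> state C e p (al p)}.
  apply: (@choice _ _ (fun p f => primitive C e p -> state C e p f)) => p.
  have [prp|] := pselect (primitive C e p); last by exists \0.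
  by have [f sf] := exists_state coneC Ce prp; exists f.
have [d dP] : {d : V -> seq V * (V -> R) & forall v,
    frame C e (d v).1 /\ v = \sum_(p <- (d v).1) (d v).2 p *: p}.
  apply: (@choice _ _ (fun v (a : seq V * (V -> R)) =>
    frame C e a.1 /\ v = \sum_(p <- a.1) a.2 p *: p)) => v.
  have [|s [c h]] := spectral_decomposition coneC splitC Ce (v := v).
    by rewrite Fe memvf.
  by exists (s, c).
(* Only [x] is decomposed, through a choice, so linearity in [y] is immediate; linearity in [x]
   follows from the symmetry [BC]. *)
pose B x y := \sum_(p <- (d x).1) (d x).2 p * al p y.
have prd x p : p \in (d x).1 -> primitive C e p by have [[_ h _] _] := dP x; exact: h.
have alC x p : p \in (d x).1 -> al p x = (d x).2 p.
  move=> ip; have [frx xE] := dP x.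
  by rewrite {1}xE (frame_coef coneC _ Ce frx ip (alP _ (prd _ _ ip))).
have BE x y : B x y = \sum_(p <- (d x).1) \sum_(q <- (d y).1)
    (d x).2 p * ((d y).2 q * al p q).
  apply: eq_bigr => p _; have [_ yE] := dP y.
  rewrite {1}yE linear_sum/= mulr_sumr; apply: eq_bigr => q _.
  by rewrite scalarZ.
have BC x y : B x y = B y x.
  rewrite !BE exchange_big/=; apply: eq_big_seq => q iq; apply: eq_big_seq => p ip.
  have prp := prd _ _ ip; have prq := prd _ _ iq.
  by rewrite (state_sym coneC splitC Ce prp prq (alP _ prp) (alP _ prq)) mulrCA.
have Bl a x y z : B x (a *: y + z) = a * B x y + B x z.
  rewrite mulr_sumr -big_split; apply: eq_bigr => p _.
  by rewrite scalarD scalarZ/=; ring.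
have Bp x : x != 0 -> 0 < B x x.
  move=> x0; have Bxx : B x x = \sum_(p <- (d x).1) (d x).2 p ^+ 2.
    by apply: eq_big_seq => p ip; rewrite alC// expr2.
  rewrite lt_neqAle Bxx sumr_ge0 ?andbT; last by move=> *; exact: sqr_ge0.
  apply: contra x0 => /eqP/esym/eqP; rewrite psumr_eq0; last by move=> *; exact: sqr_ge0.
  move=> /allP c0; have [_ ->] := dP x; rewrite big_seq big1// => p ip.
  by have := c0 _ ip; rewrite /= sqrf_eq0 => /eqP ->; rewrite scale0r.
have [ip ipE] := dot_of_fun BC Bl Bp.
exists ip; apply/seteqP; split=> y /=.
  move=> Cy x Cx; rewrite ipE; rewrite /B big_seq; apply: sumr_ge0 => p ix.
  have [_ _ pp] := alP _ (prd _ _ ix).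
  by rewrite mulr_ge0// -?alC//; apply: pp; exact: order_unit_face.
(* Pairing [y] with the vectors of its own frame gives its spectral coefficients, which are
   therefore nonnegative. *)
move=> h; have [fry yE] := dP y.
rewrite yE big_seq; elim/big_ind : _ => [||q iq]; [exact: cone0 coneC|exact: CD|].
have prq := prd _ _ iq; have [[Cq _ _] _ _] := prq.
apply: CZ => //; have := h q Cq; rewrite ipE BC /B.
rewrite (bigD1_seq q)//=; last by case: fry.
rewrite (frame_state coneC Ce fry iq iq (alP _ prq)) eqxx mulr1.
rewrite big_seq_cond big1 ?addr0// => p /andP[ip' pq].
by rewrite (frame_state coneC Ce fry ip' iq (alP _ (prd _ _ ip'))) eq_sym (negbTE pq) mulr0.
Qed.

End Symmetry.

(** * Lorentz cones and Lorentz factorization *)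

Section LorentzForm.
Variables (R : realType) (m : nat).
Implicit Types x y z P Q T : 'rV[R]_m.+1.

(** The Minkowski bilinear form. *)
Definition lorentz_form x y : R :=
  x 0 0 * y 0 0 - \sum_(i < m) x 0 (lift ord0 i) * y 0 (lift ord0 i).

Local Notation lf := lorentz_form.

Lemma lorentz_formC x y : lf x y = lf y x.
Proof.
by rewrite /lorentz_form mulrC; congr (_ - _); apply: eq_bigr => i _; rewrite mulrC.
Qed.

Lemma lorentz_formDl x y z : lf (x + y) z = lf x z + lf y z.
Proof.
rewrite /lorentz_form mxE mulrDl.
under eq_bigr do rewrite mxE mulrDl.
by rewrite big_split/=; ring.
Qed.

Lemma lorentz_formZl a x y : lf (a *: x) y = a * lf x y.
Proof.
rewrite /lorentz_form mxE mulrBr mulr_sumr mulrA; congr (_ - _).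
by apply: eq_bigr => i _; rewrite mxE mulrA.
Qed.

Lemma lorentz_formNl x y : lf (- x) y = - lf x y.
Proof. by rewrite -scaleN1r lorentz_formZl mulN1r. Qed.

Lemma lorentz_formDr x y z : lf z (x + y) = lf z x + lf z y.
Proof. by rewrite lorentz_formC lorentz_formDl !(lorentz_formC z). Qed.

Lemma lorentz_formZr a x y : lf y (a *: x) = a * lf y x.
Proof. by rewrite lorentz_formC lorentz_formZl (lorentz_formC y). Qed.

Lemma lorentz_formNr x y : lf y (- x) = - lf y x.
Proof. by rewrite lorentz_formC lorentz_formNl (lorentz_formC y). Qed.

Definition lorentz_formE := (lorentz_formDl, lorentz_formDr, lorentz_formNl,
  lorentz_formNr, lorentz_formZl, lorentz_formZr).

Lemma lorentz_coneP x : lorentz_cone x <-> 0 <= x 0 0 /\ 0 <= lf x x.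
Proof.
rewrite /lorentz_cone /lorentz_form /= subr_ge0 -expr2.
under [in X in _ /\ is_true (X <= _)]eq_bigr do rewrite -expr2.
have S0 : 0 <= \sum_(i < m) x 0 (lift ord0 i) ^+ 2.
  by apply: sumr_ge0 => *; exact: sqr_ge0.
split=> [h|[x0 h]].
  have x0 : 0 <= x 0 0 := le_trans (sqrtr_ge0 _) h.
  by split=> //; rewrite -[leLHS]sqr_sqrtr// lerXn2r// nnegrE// sqrtr_ge0.
by rewrite -[leRHS]ger0_norm// -sqrtr_sqr ler_wsqrtr.
Qed.

(** A Lagrange-type identity: it yields nonnegativity of the form between cone vectors, and its
    squares show that mutually orthogonal null vectors are proportional. *)
Lemma lorentz_form_identity x y :
  y 0 0 ^+ 2 * lf x x + x 0 0 ^+ 2 * lf y y +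
    \sum_(i < m) (x 0 (lift ord0 i) * y 0 0 - y 0 (lift ord0 i) * x 0 0) ^+ 2 =
  2 * (x 0 0 * y 0 0) * lf x y.
Proof.
under eq_bigr => i _.
  rewrite (_ : _ ^+ 2 = y 0 0 ^+ 2 * (x 0 (lift ord0 i) * x 0 (lift ord0 i)) +
     x 0 0 ^+ 2 * (y 0 (lift ord0 i) * y 0 (lift ord0 i)) +
     (- (2 * x 0 0 * y 0 0)) * (x 0 (lift ord0 i) * y 0 (lift ord0 i))); last by ring.
  over.
by rewrite !big_split/= -!mulr_sumr /lorentz_form; ring.
Qed.

Lemma lorentz_cone_eq0 x : lorentz_cone x -> x 0 0 = 0 -> x = 0.
Proof.
move=> /lorentz_coneP[_ h] x0; move: h; rewrite /lorentz_form x0 mul0r sub0r oppr_ge0 => h.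
have : \sum_(i < m) x 0 (lift ord0 i) * x 0 (lift ord0 i) == 0.
  by rewrite eq_le h sumr_ge0// => i _; rewrite -expr2 sqr_ge0.
rewrite psumr_eq0 => [/allP xi|i _]; last by rewrite -expr2 sqr_ge0.
apply/rowP => j; rewrite mxE; have [i ->|->] := unliftP ord0 j; last exact: x0.
by have := xi i (mem_index_enum _); rewrite /= mulf_eq0 orbb => /eqP.
Qed.

Lemma lorentz_form_ge0 x y : lorentz_cone x -> lorentz_cone y -> 0 <= lf x y.
Proof.
move=> Lx Ly; have [x0 qx] := (lorentz_coneP x).1 Lx; have [y0 qy] := (lorentz_coneP y).1 Ly.
move: x0; rewrite le_eqVlt => /orP[/eqP/esym/(lorentz_cone_eq0 Lx) ->|x0].
  by rewrite -(scale0r x) lorentz_formZl mul0r.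
move: y0; rewrite le_eqVlt => /orP[/eqP/esym/(lorentz_cone_eq0 Ly) ->|y0].
  by rewrite -(scale0r x) lorentz_formZr mul0r.
have := lorentz_form_identity x y.
have S0 : 0 <= \sum_(i < m) (x 0 (lift ord0 i) * y 0 0 - y 0 (lift ord0 i) * x 0 0) ^+ 2.
  by apply: sumr_ge0 => *; exact: sqr_ge0.
have h1 : 0 <= y 0 0 ^+ 2 * lf x x by rewrite mulr_ge0// sqr_ge0.
have h2 : 0 <= x 0 0 ^+ 2 * lf y y by rewrite mulr_ge0// sqr_ge0.
have xy : 0 < 2 * (x 0 0 * y 0 0) by rewrite !mulr_gt0.
by rewrite -(pmulr_rge0 _ xy) => <-; lra.
Qed.

Lemma lorentz_null_proportional x y : lf x x = 0 -> lf y y = 0 -> lf x y = 0 ->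
  y 0 0 *: x = x 0 0 *: y.
Proof.
move=> qx qy qxy; have := lorentz_form_identity x y.
rewrite qx qy qxy !mulr0 !add0r => /eqP; rewrite psumr_eq0; last by move=> *; exact: sqr_ge0.
move=> /allP h; apply/rowP => j; rewrite !mxE.
have [i ->|->] := unliftP ord0 j; last by rewrite mulrC.
have := h i (mem_index_enum _); rewrite /= sqrf_eq0 subr_eq0 => /eqP.
by rewrite mulrC => ->; rewrite mulrC.
Qed.

(** A vector with [lf T T >= 0] lies in the cone or in its opposite, and pairing with the timelike
    [E] tells which; membership is thus checked by values of the form alone. *)
Lemma lorentz_cone_timelike T E : lorentz_cone E -> 0 < lf E E -> 0 <= lf T T ->
  0 <= lf T E -> lorentz_cone T.
Proof.
move=> LE qE qT TE; apply/lorentz_coneP; split=> //; rewrite leNgt; apply/negP => T0.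
have LT : lorentz_cone (- T).
  apply/lorentz_coneP; rewrite !lorentz_formE opprK mxE; split=> //.
  by rewrite oppr_ge0 ltW.
have [E0 _] := (lorentz_coneP E).1 LE.
have TE0 : lf T E = 0.
  by apply/eqP; rewrite eq_le TE andbT -oppr_ge0 -lorentz_formNl lorentz_form_ge0.
have := lorentz_form_identity T E; rewrite TE0 mulr0.
have S0 : 0 <= \sum_(i < m) (T 0 (lift ord0 i) * E 0 0 - E 0 (lift ord0 i) * T 0 0) ^+ 2.
  by apply: sumr_ge0 => *; exact: sqr_ge0.
have h1 : 0 <= E 0 0 ^+ 2 * lf T T by rewrite mulr_ge0// sqr_ge0.
have h2 : 0 < T 0 0 ^+ 2 * lf E E by rewrite mulr_gt0// exprn_even_gt0//= lt_eqF.
by lra.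
Qed.

Lemma lorentz_timelike_dominates P Q : lorentz_cone P -> 0 < lf P P -> lorentz_cone Q ->
  exists K, lorentz_cone (K *: P - Q).
Proof.
move=> LP qP LQ; have PQ := lorentz_form_ge0 LP LQ.
have [_ qQ] := (lorentz_coneP Q).1 LQ.
(* This [K] makes [K *: P - Q] the reflection of [Q] in the axis [P], so it has the same value of
   the form as [Q]. *)
pose K := 2 * lf P Q / lf P P; have KP : K * lf P P = 2 * lf P Q by rewrite divfK ?gt_eqF.
have KKP : K * (K * lf P P) = K * (2 * lf P Q) by rewrite KP.
exists K; apply: (lorentz_cone_timelike LP qP); rewrite !lorentz_formE (lorentz_formC Q P); lra.
Qed.

(** A timelike [P] or [Q] is interior and dominates everything. Null vectors are either
    proportional, which is degenerate, or span a hyperbolic plane, and then [x] is split into its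
    coordinates there and an orthogonal rest. *)
Lemma lorentz_splitting P Q x y : lorentz_cone P -> lorentz_cone Q ->
    lorentz_cone x -> lorentz_cone y -> P + Q = x + y ->
  [\/ exists K, lorentz_cone (K *: P - x),
      exists K, lorentz_cone (K *: Q - P) |
      exists (a b : R) z, [/\ 0 <= a, 0 <= b <= 1, x = a *: P + b *: Q + z &
        hyperbola (@lorentz_cone R m) P a (b *: Q) z]].
Proof.
move=> LP LQ Lx Ly PQxy.
have [P0 qP] := (lorentz_coneP P).1 LP; have [Q0 qQ] := (lorentz_coneP Q).1 LQ.
have [x0 qx] := (lorentz_coneP x).1 Lx.
move: qP; rewrite le_eqVlt => /orP[/eqP/esym qP|qP]; last first.
  by constructor 1; exact: lorentz_timelike_dominates.
move: qQ; rewrite le_eqVlt => /orP[/eqP/esym qQ|qQ]; last first.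
  by constructor 2; exact: lorentz_timelike_dominates.
have := lorentz_form_ge0 LP LQ; rewrite le_eqVlt => /orP[/eqP/esym qPQ|N0].
  have pr := lorentz_null_proportional qP qQ qPQ.
  move: Q0; rewrite le_eqVlt => /orP[/eqP/esym/(lorentz_cone_eq0 LQ) Q0|Q0].
    constructor 1; exists 1; rewrite scale1r.
    by move: PQxy; rewrite Q0 addr0 => ->; rewrite addrC addKr.
  constructor 2; exists (P 0 0 / Q 0 0).
  rewrite mulrC -scalerA -pr scalerA mulVf ?gt_eqF// scale1r subrr.
  apply/lorentz_coneP; rewrite mxE (_ : lf 0 0 = 0)//.
  by rewrite -[X in lf X _](scale0r 0) lorentz_formZl mul0r.
constructor 3.
pose N := lf P Q; pose a := lf x Q / N; pose b := lf x P / N.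
have a0 : 0 <= a by rewrite divr_ge0 ?(ltW N0)// lorentz_form_ge0.
have b0 : 0 <= b by rewrite divr_ge0 ?(ltW N0)// lorentz_form_ge0.
have aN : a * N = lf x Q by rewrite divfK// gt_eqF.
have bN : b * N = lf x P by rewrite divfK// gt_eqF.
have QP : lf Q P = N by exact: lorentz_formC.
have PQ : lf P Q = N by [].
have b1 : b <= 1.
  have yP := lorentz_form_ge0 Ly LP.
  have := congr1 (lf^~ P) PQxy; rewrite !lorentz_formE qP QP -bN => e1.
  by rewrite -(ler_pM2r N0) mul1r -/N; lra.
pose z := x - a *: P - b *: Q.
have zP : lf z P = 0 by rewrite /z !lorentz_formE qP QP -bN; ring.
have zQ : lf z Q = 0 by rewrite /z !lorentz_formE qQ PQ -aN; ring.
have zz : lf z z = lf x x - 2 * a * b * N.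
  by rewrite /z !lorentz_formE qP qQ PQ QP (lorentz_formC P) (lorentz_formC Q) -aN -bN; ring.
have xE : x = a *: P + b *: Q + z by rewrite /z; vring.
clearbody z N a b.
exists a, b, z; split; rewrite ?a0 ?b0//.
have LE : lorentz_cone (P + Q).
  apply/lorentz_coneP; rewrite mxE addr_ge0// !lorentz_formE qP qQ PQ QP.
  by split=> //; move: N0; rewrite -/N; lra.
have qE : 0 < lf (P + Q) (P + Q).
  by rewrite !lorentz_formE qP qQ PQ QP; move: N0; rewrite -/N; lra.
(* These points arise from [x] by a boost of the hyperbolic plane and, for [c = -1], a change of
   sign of [z]; the form keeps the value [lf x x]. *)
have key (tau c : R) : 0 < tau -> c ^+ 2 = 1 ->
    lorentz_cone ((tau * a) *: P + tau^-1 *: (b *: Q) + c *: z).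
  move=> t0 c1; apply: (lorentz_cone_timelike LE qE).
    rewrite !lorentz_formE qP qQ PQ QP (lorentz_formC P z) (lorentz_formC Q z) zP zQ zz.
    set X := (X in 0 <= X).
    have -> : X = lf x x + (c ^+ 2 - 1) * (lf x x - 2 * a * b * N).
      by rewrite /X; field; rewrite gt_eqF.
    by rewrite c1 subrr mul0r addr0.
  rewrite !lorentz_formE qP qQ PQ QP zP zQ.
  have N1 : 0 <= N by rewrite -PQ ltW.
  have h1 : 0 <= tau * a * N by rewrite !mulr_ge0 ?(ltW t0).
  have h2 : 0 <= tau^-1 * (b * N) by rewrite !mulr_ge0 ?invr_ge0 ?(ltW t0).
  by lra.
move=> tau t0; split.
  by rewrite -[z]scale1r; apply: key => //; rewrite expr1n.
by rewrite -[z]scale1r -scaleNr; apply: key => //; rewrite sqrrN expr1n.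
Qed.

End LorentzForm.

(** * Splittings obtained from maps factoring through Lorentz cones *)

Section Factorization.
Variables (R : realType) (V : vectType R) (C : set V).
Hypothesis coneC : closed_cone C.

Let C0 := cone0 coneC.
Let CD := coneD coneC.
Let CZ := coneZ coneC.
Let Cpt := cone_pointed coneC.

Lemma extreme_le a c (t : R) : extreme C a -> C c -> C (t *: a - c) ->
  exists2 s : R, 0 <= s & c = s *: a.
Proof.
move=> [Ca a0 Ea] Cc Ct; have [t0|t0] := lerP t 0.
  exists 0; rewrite // scale0r; apply: Cpt => //.
  have h : 0 <= - t by lra.
  by apply: (eq_mem_set (CD Ct (CZ h Ca))); vring.
have ti : 0 <= t^-1 by rewrite invr_ge0 ltW.
have [||s sE] := Ea (t^-1 *: c); first exact: CZ.
  by apply: (eq_mem_set (CZ ti Ct)); vring.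
have cE : c = (t * s) *: a by rewrite -scalerA -sE scalerA mulfV ?gt_eqF// scale1r.
exists (t * s) => //; rewrite leNgt; apply/negP => ts.
apply: a0; apply: Cpt => //; rewrite cE in Cc.
have h : 0 <= - (t * s)^-1 by rewrite oppr_ge0 invr_le0 ltW.
by apply: (eq_mem_set (CZ h Cc)); rewrite scalerA mulNr mulVf ?lt_eqF// scaleN1r.
Qed.

(** The conclusion of [peirce_splitting], isolated because it is additive and homogeneous in the
    pair [(c, b)]. *)
Definition split_along a c b : Prop := exists (al : R) u w,
  [/\ 0 <= al, C u, C (b - u), c = al *: a + u + w & hyperbola C a al u w].

Lemma split_alongD a c b c' b' : split_along a c b -> split_along a c' b' ->
  split_along a (c + c') (b + b').
Proof.
move=> [al [u [w [al0 Cu Cbu -> h]]]] [al' [u' [w' [al0' Cu' Cbu' -> h']]]].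
exists (al + al'), (u + u'), (w + w'); split.
- exact: addr_ge0.
- exact: CD.
- by apply: (eq_mem_set (CD Cbu Cbu')); vring.
- by vring.
move=> tau t0; have [h1 h2] := h _ t0; have [h1' h2'] := h' _ t0.
by split; [apply: (eq_mem_set (CD h1 h1'))|apply: (eq_mem_set (CD h2 h2'))]; vring.
Qed.

Lemma split_alongZ a c b (k : R) : 0 <= k -> split_along a c b ->
  split_along a (k *: c) (k *: b).
Proof.
move=> k0 [al [u [w [al0 Cu Cbu -> h]]]].
exists (k * al), (k *: u), (k *: w); split.
- exact: mulr_ge0.
- exact: CZ.
- by apply: (eq_mem_set (CZ k0 Cbu)); vring.
- by vring.
move=> tau t0; have [h1 h2] := h _ t0.
by split; [apply: (eq_mem_set (CZ k0 h1))|apply: (eq_mem_set (CZ k0 h2))]; vring.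
Qed.

Lemma split_along_le a c b : C a -> C c -> C (b - c) -> split_along a c b.
Proof.
move=> Ca Cc Cbc; exists 0, c, 0; split=> //; first by vring.
move=> tau t0; have ti : 0 <= tau^-1 by rewrite invr_ge0 ltW.
by split; apply: (eq_mem_set (CZ ti Cc)); vring.
Qed.

Lemma split_along_ray a b (s : R) : C a -> C b -> 0 <= s -> split_along a (s *: a) b.
Proof.
move=> Ca Cb s0; exists s, 0, 0; split=> //.
- by rewrite subr0.
- by vring.
by move=> tau t0; split; apply: (eq_mem_set (CZ (mulr_ge0 (ltW t0) s0) Ca)); vring.
Qed.

(** Push [lorentz_splitting] forward by [beta]. If [P] dominates [x], extremality puts [beta x] on
    the ray of [a]; if [Q] dominates [P], then [l = 0] because [b] dominates no positive multiple of
    [a], and [beta x <= beta Q]. *)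
Lemma lorentz_split_along m (beta : 'Hom('rV[R]_m.+1, V)) P Q x y a b (l : R) :
    (forall v, lorentz_cone v -> C (beta v)) ->
    lorentz_cone P -> lorentz_cone Q -> lorentz_cone x -> lorentz_cone y ->
    P + Q = x + y -> extreme C a -> C b -> (forall K : R, ~ C (K *: b - a)) ->
    beta P = l *: a -> face C b (beta Q) ->
  split_along a (beta x) (beta Q).
Proof.
move=> bC LP LQ Lx Ly PQxy ea Cb nba bP fQ; have [Ca a0 _] := ea.
have CbP := bC _ LP; have CbQ := bC _ LQ; have Cbx := bC _ Lx; have Cby := bC _ Ly.
have [|l' l0 lE] := @extreme_le a (beta P) l ea CbP.
  by rewrite bP subrr.
have ll : l = l'.
  move: bP; rewrite lE => /eqP; rewrite -subr_eq0 -scalerBl scaler_eq0.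
  by move=> /orP[|/eqP //]; rewrite subr_eq0 => /eqP.
rewrite -{}ll {l' lE} in l0.
have [[K LK]|[K LK]|[r [s [z [r0 /andP[s0 s1] xE hyp]]]]] :=
  lorentz_splitting LP LQ Lx Ly PQxy.
- have [|t t0 ->] := @extreme_le a (beta x) (K * l) ea Cbx.
    by apply: (eq_mem_set (bC _ LK)); rewrite !(hom_morphE beta) bP scalerA.
  exact: split_along_ray.
- have l00 : l = 0.
    apply/eqP; rewrite eq_le l0 andbT leNgt; apply/negP => lp.
    have [M M0 CM] := face_coef_gt0 coneC Cb fQ.
    apply: (nba (l^-1 * (`|K| * M))).
    have h : 0 <= l^-1 by rewrite invr_ge0 ltW.
    have h1 : 0 <= `|K| by [].
    have h2 : 0 <= `|K| - K by have := ler_norm K; lra.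
    apply: (eq_mem_set (CZ h (CD (CZ h1 CM) (CD (CZ h2 CbQ) (bC _ LK))))).
    by rewrite !(hom_morphE beta) bP; vring.
  apply: split_along_le => //; apply: (eq_mem_set Cby).
  have := congr1 beta PQxy; rewrite !(homD beta) bP l00 scale0r add0r => ->.
  by vring.
exists (l * r), (s *: beta Q), (beta z); split.
- exact: mulr_ge0.
- exact: CZ.
- have h : 0 <= 1 - s by lra.
  by apply: (eq_mem_set (CZ h CbQ)); vring.
- by rewrite {1}xE !(hom_morphE beta) bP; vring.
move=> tau t0; have [/bC h1 /bC h2] := hyp _ t0; split.
  by apply: (eq_mem_set h1); rewrite !(hom_morphE beta) bP; vring.
by apply: (eq_mem_set h2); rewrite !(hom_morphE beta) bP; vring.
Qed.

Let sq (y z : R) : 'rV[R]_3 := \row_i [:: 1; y; z]`_i.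

Let sq_in y z : `|y| + `|z| <= 1 -> square_cone (sq y z).
Proof. by rewrite /square_cone /= !mxE. Qed.

Lemma LFP_peirce_splitting : LFP (@square_cone R) C -> peirce_splitting C.
Proof.
move=> LF a b c ea Cb nba Cc Cd; have [Ca _ _] := ea.
pose v1 := sq 1 0; pose v2 := sq (-1) 0; pose v3 := sq 0 1; pose v4 := sq 0 (-1).
have s1 : square_cone v1 by apply: sq_in; rewrite normr1 normr0; lra.
have s2 : square_cone v2 by apply: sq_in; rewrite normrN normr1 normr0; lra.
have s3 : square_cone v3 by apply: sq_in; rewrite normr1 normr0; lra.
have s4 : square_cone v4 by apply: sq_in; rewrite normrN normr1 normr0; lra.
have vE : v1 + v2 = v3 + v4.
  apply/rowP => i; rewrite !mxE; case: i => -[|[|[|//]]] //= _; ring.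
(* The two premises, [P v1] on the line of [a] and [P v2] in the face of [b], pass to the summands
   of a convex combination, which makes [S] convex. *)
pose S := [set P : 'Hom('rV[R]_3, V) | Pos (@square_cone R) C P /\
  ((exists l, P v1 = l *: a) -> face C b (P v2) -> split_along a (P v3) (P v2))].
have [P PE] : exists P : 'Hom('rV[R]_3, V), forall v, P v =
    (v 0 0 / 2) *: (a + b) + (v 0 1 / 2) *: (a - b) + v 0 2 *: (c - 2^-1 *: (a + b)).
  apply: (@lfun_of_fun _ _ _ (fun v => _)) => k x y; rewrite !mxE; vring.
have P1 : P v1 = a by rewrite PE !mxE/=; vring.
have P2 : P v2 = b by rewrite PE !mxE/=; vring.
have P3 : P v3 = c by rewrite PE !mxE/=; vring.
suff : S P by move=> [_]; rewrite P1 P2 P3; apply; [exists 1; rewrite scale1r|exact: face_self].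
suff LS : LorFact (@square_cone R) C `<=` S.
  apply: LS; rewrite LF => _ [v + <-]; rewrite /square_cone/= => sv.
  (* [v] is a nonnegative combination of [v1 + v2], of one of [v1], [v2] and of one of [v3], [v4],
     chosen by the signs of its coordinates. *)
  have h : 0 <= (v 0 0 - `|v 0 1| - `|v 0 2|) / 2 by rewrite divr_ge0//; lra.
  have Cy : C ((`|v 0 1| / 2) *: (a + b) + (v 0 1 / 2) *: (a - b)).
    have [y0|y0] := lerP 0 (v 0 1); first by apply: (eq_mem_set (CZ y0 Ca)); rewrite ?ger0_norm//; vring.
    have y1 : 0 <= - v 0 1 by lra.
    by apply: (eq_mem_set (CZ y1 Cb)); rewrite ?ltr0_norm//; vring.
  have Cz : C ((`|v 0 2| / 2) *: (a + b) + v 0 2 *: (c - 2^-1 *: (a + b))).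
    have [y0|y0] := lerP 0 (v 0 2); first by apply: (eq_mem_set (CZ y0 Cc)); rewrite ?ger0_norm//; vring.
    have y1 : 0 <= - v 0 2 by lra.
    by apply: (eq_mem_set (CZ y1 Cd)); rewrite ?ltr0_norm//; vring.
  rewrite PE; apply: (eq_mem_set (CD (CZ h (CD Ca Cb)) (CD Cy Cz))).
  by vring.
apply: smallest_sub.
  apply/convex_setW => X Y; rewrite !inE => -[pX gX] [pY gY] k k0 k1.
  rewrite inE; have k1' : 0 < 1 - k%:num by lra.
  have E v : (conv k X Y : 'Hom(_, _)) v = k%:num *: X v + (1 - k%:num) *: Y v.
    by rewrite add_lfunE !scale_lfunE.
  have CX v : square_cone v -> C (k%:num *: X v).
    by move=> sv; apply: CZ; [exact: ltW|apply: pX; exists v].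
  have CY v : square_cone v -> C ((1 - k%:num) *: Y v).
    by move=> sv; apply: CZ; [exact: ltW|apply: pY; exists v].
  split=> [_ [v sv <-]|].
    by rewrite E; apply: CD; [exact: CX|exact: CY].
  rewrite !E => -[l lE] f2.
  have unscale (t : R) x : 0 < t -> (exists l, t *: x = l *: a) -> exists l, x = l *: a.
    move=> t0 [l' l'E]; exists (t^-1 * l').
    by rewrite -scalerA -l'E scalerA mulVf ?gt_eqF// scale1r.
  have unface (t : R) x : 0 < t -> face C b (t *: x) -> face C b x.
    move=> t0 fx; have ti : 0 <= t^-1 by rewrite invr_ge0 ltW.
    by have := faceZ coneC ti fx; rewrite scalerA mulVf ?gt_eqF// scale1r.
  apply: split_alongD; apply: split_alongZ; try exact: ltW.
    apply: gX.
      apply: (unscale _ _ k0).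
      have [|s _ sE] := @extreme_le a (k%:num *: X v1) l ea (CX _ s1); last by exists s.
      by rewrite -lE; apply: (eq_mem_set (CY _ s1)); vring.
    apply: (unface _ _ k0); apply: (face_le coneC (CX _ s2) _ f2).
    by apply: (eq_mem_set (CY _ s2)); vring.
  apply: gY.
    apply: (unscale _ _ k1').
    have [|s _ sE] := @extreme_le a ((1 - k%:num) *: Y v1) l ea (CY _ s1); last by exists s.
    by rewrite -lE; apply: (eq_mem_set (CX _ s1)); vring.
  apply: (unface _ _ k1'); apply: (face_le coneC (CY _ s2) _ f2).
  by apply: (eq_mem_set (CX _ s2)); vring.
move=> _ [W [L [al [be [[m [f [bf fL]]] pal pbe ->]]]]].
have kf : lker f == 0%VS by apply/lker0P; exact: bij_inj.
have fV x : (f^-1)%VF (f x) = x by exact: lker0_lfunK.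
have bC (v : 'rV_m.+1) : lorentz_cone v -> C ((be \o f^-1)%VF v).
  by rewrite -[lorentz_cone _]/(lorentz_cone _) -fL => -[x Lx <-]; rewrite comp_lfunE fV; apply: pbe; exists x.
have aL v : square_cone v -> lorentz_cone (f (al v)).
  by move=> sv; rewrite -fL; exists (al v) => //; apply: pal; exists v.
have bE v : (be \o al)%VF v = (be \o f^-1)%VF (f (al v)) by rewrite !comp_lfunE fV.
split=> [_ [v sv <-]|[l]]; first by rewrite bE; exact/bC/aL.
rewrite !bE => lE f2.
apply: (@lorentz_split_along m (be \o f^-1)%VF (f (al v1)) _ _ (f (al v4)) a b l) => //; try exact: aL.
by rewrite -!linearD vE.
Qed.

End Factorization.

(** * Topology *)

Section ProperCone.
Variables (R : realType) (V : vectType R) (C : set V).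

(** Closedness and interior points are both tested along affine lines. *)
Lemma line_continuous (x y : V) : continuous (fun t : R => x + t *: y : @vtop R V).
Proof.
apply: continuous_comp_initial.
rewrite (_ : _ \o _ = fun t : R => passmx.rVof (vbasis {:V}) x + t *: passmx.rVof (vbasis {:V}) y).
  by move=> t; apply: cvgD; [exact: cvg_cst|exact: scalel_continuous].
by apply/funext => t /=; apply/rowP => i; rewrite !mxE linearD linearZ.
Qed.

Lemma nbhs_line (x y : V) (A : set (@vtop R V)) : nbhs (x : @vtop R V) A ->
  exists2 eps : R, 0 < eps & forall t, `|t| < eps -> A (x + t *: y).
Proof.
rewrite -{1}[x]addr0 -(scale0r y) => /(@line_continuous x y 0) /nbhs_ballP[eps /= e0 h].
by exists eps => // t te; apply: h; rewrite /ball/= sub0r normrN.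
Qed.

Hypothesis properC : proper_cone C.

Lemma proper_closed_cone : closed_cone C.
Proof.
have [cC clC ptC _] := properC.
have C0 : C 0 by have : [set 0 : V] 0 by []; rewrite -ptC => -[].
split=> //.
- by move=> x y Cx Cy; have := cC 1 1 x y ler01 ler01 Cx Cy; rewrite !scale1r.
- by move=> t x t0 Cx; have := cC t 0 x 0 t0 (lexx 0) Cx C0; rewrite scaler0 addr0.
- by move=> x Cx Cnx; have : (C `&` [set x | C (- x)]) x by []; rewrite ptC.
move=> x y h; apply: clC => B /nbhs_line => /(_ y)[eps eps0 hB].
have e2 : 0 < eps / 2 by rewrite divr_gt0.
exists (x + (eps / 2) *: y); split; first exact: h.
by apply: hB; rewrite ger0_norm ?(ltW e2)//; lra.
Qed.

Let coneC := proper_closed_cone.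
Let CD := coneD coneC.
Let CZ := coneZ coneC.

Lemma interior_order_unit x : interior (C : set (@vtop R V)) x -> order_unit C x.
Proof.
move=> ix; have Cx : C x by exact: interior_subset ix.
split=> //; apply/vspaceP => v; rewrite memvf; apply/mem_face_span => //.
have [eps e0 h] := nbhs_line v ix.
have e2 : 0 < eps / 2 by rewrite divr_gt0.
have ei : 0 <= (eps / 2)^-1 by rewrite invr_ge0 ltW.
have h1 : C (x + (eps / 2) *: v) by apply: h; rewrite ger0_norm ?(ltW e2)//; lra.
have h2 : C (x + (- (eps / 2)) *: v).
  by apply: h; rewrite normrN ger0_norm ?(ltW e2)//; lra.
exists (eps / 2)^-1; split.
  by apply: (eq_mem_set (CZ ei h1)); rewrite scalerDr scalerA mulVf ?gt_eqF// scale1r.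
apply: (eq_mem_set (CZ ei h2)).
by rewrite scalerDr scalerA mulrN mulVf ?gt_eqF// scaleN1r.
Qed.

(** Take [e] whose face has a span of largest dimension: for [c] in [C], the face of [e + c]
    contains [c] and has the same span. *)
Lemma exists_order_unit : exists e, order_unit C e.
Proof.
have [_ _ _ full] := properC.
pose good n := `[< exists2 e, C e & \dim (face_span C e) = n >].
have ex : exists n, good n.
  by exists (\dim (face_span C 0)); apply/asboolP; exists 0 => //; exact: cone0 coneC.
have bd n : good n -> (n <= \dim {:V})%N.
  by move=> /asboolP[e _ <-]; exact: dimvS (subvf _).
case: (ex_maxnP ex bd) => n /asboolP[e Ce de] nmax.
exists e; split=> //; apply/eqP; rewrite eqEsubv subvf -full.
have [_] := least_subspaceP C; apply => c Cc /=.
have Cec : C (e + c) by exact: CD.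
have fe : face C (e + c) e.
  by apply: (face_le coneC Ce _ (face_self coneC Cec)); apply: (eq_mem_set Cc); vring.
have fc : face C (e + c) c.
  by apply: (face_le coneC Cc _ (face_self coneC Cec)); apply: (eq_mem_set Ce); vring.
have sub := face_span_sub coneC Cec fe.
have /eqP -> : face_span C e == face_span C (e + c).
  by rewrite eqEdim sub de nmax//; apply/asboolP; exists (e + c).
exact: face_sub_span.
Qed.

End ProperCone.

(** * Symmetry of cones with the Lorentz factorization property *)

Theorem theorem5 (R : realType) (V : vectType R) (C : set V)
    (C_proper : proper_cone C) (C_dim : (cone_dim C <= 5)%N)
    (C_LFP : LFP (@square_cone R) C) :
  symmetric_cone C.
Proof.
have coneC := proper_closed_cone C_proper.
have splitC := LFP_peirce_splitting coneC C_LFP.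
split=> //; first by have [e ue] := exists_order_unit C_proper; exact: order_unit_selfdual ue.
move=> x y /(interior_order_unit C_proper) ux /(interior_order_unit C_proper) uy.
exact: order_unit_transitive.
Qed.
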